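(* Let $\alpha>0$ and $\beta_0>\beta_1>0$ (and it may be that $\beta_0=\infty$) be given, let $C'>0$ be given, and let $\mathcal I_1,\mathcal I_2$ be two closed intervals of $(0,\infty)$. Let $\tau\in\mathcal I_1$, $C\in\mathcal I_2$ be two unknown parameters. An $\alpha$-uniformly consistent test for the testing problem $$H_0:\ F\in\bigcup_{\tau\in\mathcal I_1,\,C\in\mathcal I_2}\mathcal S(\tau,\beta_0,C,C')\quad\text{vs.}\quad H_1:\ F\in\bigcup_{\tau\in\mathcal I_1,\,C\in\mathcal I_2}\tilde{\mathcal S}(\tau,\beta_1,\beta_0,C,C',\rho_n)$$ exists for some sequence $(\rho_n)_n$ such that $$\limsup_{n\to\infty}\rho_n\,\frac{n^{\beta_1/(2\beta_1+1)}}{\log(n)}<\infty .$$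
   Context: $\mathcal D$ denotes the set of càdlàg distribution functions of probability distributions on $\mathbb R^+$. For $\tau,\beta,C,C'>0$, $$\mathcal S(\tau,\beta,C,C')=\{F\in\mathcal D:\ \forall x \text{ with } F(x)\in(0,1],\ |1-F(x)-Cx^{-\tau}|\le C'x^{-\tau(\beta+1)}\}.$$ For $\beta=\infty$, $\mathcal S(\tau,\infty,C,C')$ contains only the distribution $F_0(x)=1-Cx^{-\tau}$ for $x\ge C^{1/\tau}$. Distance: $\|F-F_0\|_{\infty,\tau}=\sup_{x:\,F(x)\in(0,1)}|x^\tau(1-F(x))-x^\tau(1-F_0(x))|$, and $\|F-\mathcal A\|_{\infty,\tau}=\inf_{F_0\in\mathcal A}\|F-F_0\|_{\infty,\tau}$ for a set $\mathcal A$ of distributions. For $\rho\ge0$, $$\tilde{\mathcal S}(\tau,\beta_1,\beta_0,C,C',\rho)=\{F\in\mathcal S(\tau,\beta_1,C,C'):\ \|F-\mathcal S(\tau,\beta_0,C,C')\|_{\infty,\tau}\ge\rho\}.$$ A test $\Psi_n$ is a $\{0,1\}$-valued measurable function of $n$ i.i.d. observations $X_1,\dots,X_n$ from $F$ (it may not depend on the unknown $\tau,C$). It is $\alpha$-uniformly consistent between $H_0$ and $H_1$ if for $n$ large enough $$\sup_{F\in H_0}\mathbb E_F\Psi_n+\sup_{F\in H_1}\mathbb E_F(1-\Psi_n)\le\alpha .$$ *)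

(* Defs.v *)
From HB Require Import structures.
From mathcomp Require Import all_boot all_order all_algebra.
From mathcomp Require Import all_classical all_reals all_analysis.

Set Implicit Arguments.
Unset Strict Implicit.
Unset Printing Implicit Defensive.

Import Order.TTheory GRing.Theory Num.Theory.
Import numFieldNormedType.Exports.

Local Open Scope classical_set_scope.
Local Open Scope ring_scope.

Section iid_law.
Context d (T : measurableType d) (R : realType) (P : probability T R).

Definition tuple_cons (n : nat) (z : T * n.-tuple T) : n.+1.-tuple T :=
  [tuple of z.1 :: z.2].

Lemma measurable_tuple_cons (n : nat) :
  measurable_fun [set: T * n.-tuple T] (@tuple_cons n).
Proof. exact: measurable_cons. Qed.

HB.instance Definition _ (n : nat) :=
  @isMeasurableFun.Build _ _ _ _ (@tuple_cons n) (@measurable_tuple_cons n).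

(* The n-fold product measure, i.e. the joint law of n independent
   observations from P; see [iid_lawE] for the product rule. *)
Fixpoint iid_law (n : nat) : probability (n.-tuple T) R :=
  match n with
  | 0 => \d_([tuple])
  | m.+1 => distribution (P \x iid_law m)%E (@tuple_cons m)
  end.

Lemma measurable_tuple_box (n : nat) (A : 'I_n -> set T) :
  (forall i, measurable (A i)) ->
  measurable [set t : n.-tuple T | forall i, A i (tnth t i)].
Proof.
move=> mA.
rewrite (_ : [set _ | _] =
  \bigcap_(i in [set: 'I_n]) ((@tnth n T ^~ i) @^-1` A i)); last first.
  by apply/seteqP; split=> t /= h i; [move=> _|]; exact: h.
apply: fin_bigcap_measurable => // i _.
by have := @measurable_tnth d T n i measurableT (A i) (mA i); rewrite setTI.
Qed.

Lemma iid_lawE (n : nat) (A : 'I_n -> set T) :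
  (forall i, measurable (A i)) ->
  iid_law n [set t | forall i, A i (tnth t i)] = (\prod_(i < n) P (A i))%E.
Proof.
elim: n A => [|n IHn] A mA /=.
  rewrite big_ord0 diracE.
  by rewrite (mem_set _)// => -[].
rewrite big_ord_recl -IHn//.
have mB := @measurable_tuple_box n _ (fun i => mA (lift ord0 i)).
rewrite -product_measure1E//.
rewrite /distribution /pushforward/=; congr (_ _).
apply/seteqP; split=> -[x t] /=.
  move=> h; split; first exact: (h ord0).
  by move=> i; have := h (lift ord0 i); rewrite tnthS.
move=> [h0 h] i; case: (unliftP ord0 i) => [j ->|->]; last exact: h0.
by rewrite tnthS; exact: h.
Qed.

End iid_law.

Section tail_classes.
Context {R : realType}.
Implicit Types (tau C rho x : R) (beta : \bar R).

(* Nondecreasing right-continuous functions tending to 0 at -oo and 1 at +oo. *)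
Definition distr_fun := cumulativeBounded (0 : R) (1 : R).
Implicit Types (F G : distr_fun) (A H : set distr_fun).

Definition nneg_supported : set distr_fun :=
  [set F | forall x, x < 0 -> F x = 0].

Definition pareto tau C x : R :=
  if C `^ tau^-1 <= x then 1 - C * x `^ (- tau) else 0.

(* The bound is imposed at positive x only: [0 `^ (- tau)] is the junk value 0
   here, whereas mathematically both sides are infinite at 0. *)
Definition second_order_pareto tau beta C (C' : R) : set distr_fun :=
  [set F | nneg_supported F /\
    match beta with
    | b%:E => forall x, 0 < x -> 0 < F x <= 1 ->
        `|1 - F x - C * x `^ (- tau)| <= C' * x `^ (- (tau * (b + 1)))
    | +oo%E => forall x, F x = pareto tau C x
    | -oo%E => False
    end].

Definition tail_dist tau F G : \bar R :=
  ereal_sup [set `|x `^ tau * (1 - F x) - x `^ tau * (1 - G x)|%:E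
            | x in [set x | 0 < F x < 1]].

Definition tail_dist_set tau F A : \bar R :=
  ereal_inf [set tail_dist tau F G | G in A].

Definition separated_pareto tau beta1 beta0 C (C' : R) rho : set distr_fun :=
  [set F | second_order_pareto tau beta1 C C' F /\
    (rho%:E <= tail_dist_set tau F (second_order_pareto tau beta0 C C'))%E].

Definition test (n : nat) : Type :=
  {mfun n.-tuple (measurableTypeR R) >-> bool}.

Definition expect n F (f : n.-tuple (measurableTypeR R) -> R) : \bar R :=
  'E_(iid_law (lebesgue_stieltjes_measure F) n)[f].

(* Adjoining 0 makes the supremum over an empty hypothesis 0 rather than -oo. *)
Definition sup_expect n H (f : n.-tuple (measurableTypeR R) -> R) : \bar R :=
  ereal_sup ([set 0%E] `|` [set expect F f | F in H]).

Definition uniformly_consistent (alpha : R) (Psi : forall n, test n)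
    (H0 : set distr_fun) (H1 : nat -> set distr_fun) : Prop :=
  \forall n \near \oo,
    (sup_expect H0 (fun t => (Psi n t)%:R%R) +
     sup_expect (H1 n) (fun t => 1 - (Psi n t)%:R)%R <= alpha%:E)%E.

End tail_classes.

Arguments distr_fun R : clear implicits.
Arguments test R n : clear implicits.

(* Main.v *)
(* The empirical tail of an n-sample has relative error of order
   sqrt(x^tau log n / n) at x, uniformly in x, by a Bernstein bound at the
   quantiles of F.  The test accepts when the sample is compatible with some F0 in
   the null hypothesis, and compatible means close to F0 in that sense, together
   with a sharper error, without the logarithm, at the seven points e^j with
   |j - K / tau| <= 3, where K = log n / (2 beta1 + 1).  If both F0 in the null
   hypothesis and F1 in the alternative are compatible with the same sample, then
   evaluating both tails at two of these points, where variance and bias balance,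
   gives |tau0 - tau1| = O(r) and |log C0 - log C1| = O(r log n) with
   r = n^(-beta1 / (2 beta1 + 1)); this logarithm is the one in the rate.  Hence
   the bands of F0 and of the class with the parameters of F1 differ by
   O(r log n x^-tau1), and truncating F1 to the latter band gives an element of
   that class within O(r log n) of F1.
   Measurability: the test only depends on the finite table of comparisons of the
   observations with each other and with a fixed logarithmic grid.  Equality of
   tables still transports the tail counts, up to moving x inside a grid cell. *)
From HB Require Import structures.
Require Import Defs.
From mathcomp Require Import all_boot all_order all_algebra.
From mathcomp Require Import all_classical all_reals all_analysis.
From mathcomp Require Import measurable_realfun.
From mathcomp Require Import ring lra zify.
Import Order.TTheory GRing.Theory Num.Theory.
Import numFieldNormedType.Exports.

Set Implicit Arguments.
Unset Strict Implicit.
Unset Printing Implicit Defensive.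

Local Open Scope classical_set_scope.
Local Open Scope ring_scope.

(** * Uniform deviations of the empirical tail *)

(** An error [d] on [tau] becomes an error [d * y] on the logarithm of the tail at [e^y], with [y]
    ranging up to order [log n]. Estimating [tau] from the uniform deviation, which already costs a
    logarithmic factor, would compound the two losses. At a fixed number of points the union bound
    costs a constant, so a level [M] depending on [alpha] alone suffices; but the right points
    depend on the unknown [tau], and each distribution is controlled on its own window only. The
    uniform deviation therefore serves first to show that the two windows overlap enough. The value
    of [K] comes from [1 / n = r^2 e^-K] with [r = e^(-b1 K)]: at tail mass [e^-K], relative noise
    and relative bias are both of order [r]. Measurability is an obstacle because acceptance is
    existential over an uncountable class. Any set of tables has a measurable preimage, but the two
    distributions are then seen through two different samples sharing a table. Randomness ends
    there: what survives is the relation [coupled], and the rest is deterministic. *)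

Section binomial_tail.
Context d (T : measurableType d) (R : realType) (P : probability T R).
Implicit Types (A : set T) (n : nat).

Lemma measurable_prod_tnth n (f : T -> R) : measurable_fun setT f ->
  measurable_fun setT (fun t : n.-tuple T => \prod_(i < n) f (tnth t i)).
Proof.
move=> mf; apply: measurable_prod => i _.
by apply: measurableT_comp => //; exact: measurable_tnth.
Qed.

(** Fubini along the recursion defining [iid_law]. With an exponential [f] it turns the moment
    generating function of a count into an [n]-th power. *)
Lemma integral_iid_prod n (f : T -> R) : measurable_fun setT f ->
    (forall x, 0 <= f x) ->
  (\int[iid_law P n]_t (\prod_(i < n) f (tnth t i))%:E =
   (\int[P]_x (f x)%:E) ^+ n)%E.
Proof.
move=> mf f0; elim: n => [|n IHn].
  rewrite integral_dirac//=; last first.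
    by apply/measurable_EFinP; exact: measurable_prod_tnth.
  rewrite diracT mul1e big_ord0; by [].
rewrite expeS.
have mp k : measurable_fun setT
    (fun t : k.-tuple T => (\prod_(i < k) f (tnth t i))%:E).
  by apply/measurable_EFinP; exact: measurable_prod_tnth.
rewrite ge0_integral_distribution; last 2 first.
- exact: mp.
- by move=> t; rewrite lee_fin prodr_ge0.
rewrite fubini_tonelli1; last 2 first.
- apply: measurableT_comp; last exact: measurable_tuple_cons.
  exact: mp.
- by move=> t; rewrite lee_fin prodr_ge0.
rewrite /fubini_F.
under eq_integral => x _.
  rewrite (_ : (\int[_]_y _ = (f x)%:E * (\int[P]_x (f x)%:E) ^+ n)%E); last first.
    rewrite -IHn -ge0_integralZl//; last 3 first.
    - exact: mp.
    - by move=> t _; rewrite lee_fin prodr_ge0.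
    - by rewrite lee_fin.
    apply: eq_integral => t _ /=.
    rewrite big_ord_recl -EFinM; congr (_ * _)%:E.
    by apply: eq_bigr => i _; rewrite tnthS.
  over.
rewrite ge0_integralZr//.
- by apply/measurable_EFinP.
- by move=> x _; rewrite lee_fin.
- by rewrite expe_ge0// integral_ge0// => x _; rewrite lee_fin.
Qed.

Lemma measure_le_integral d' (T' : measurableType d') (mu : {measure set T' -> \bar R})
    (B : set T') (g : T' -> R) :
  measurable B -> measurable_fun setT g -> (forall x, 0 <= g x) ->
  (forall x, B x -> 1 <= g x) -> (mu B <= \int[mu]_x (g x)%:E)%E.
Proof.
move=> mB mg g0 g1; rewrite -[B]setIT -integral_indic//.
apply: ge0_le_integral => //=.
- by apply/measurable_EFinP; exact: measurable_indic.
- by apply/measurable_EFinP.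
- move=> x _; rewrite lee_fin indicE.
  by case: (boolP (x \in B)) => // /set_mem Bx; rewrite g1.
Qed.

Definition hits n A (t : n.-tuple T) : R := \sum_(i < n) \1_A (tnth t i).

Lemma measurable_hits n A : measurable A -> measurable_fun setT (@hits n A).
Proof.
move=> mA; apply: measurable_sum => i.
by apply: measurableT_comp => //; exact: measurable_tnth.
Qed.

(** Since [1 - x <= expR (- x)], it is enough that the quadratic times [1 - x] be at least 1, which
    reads [x^2 (1 - 2 x) >= 0]. *)
Lemma expR_le1DxDxx (x : R) : `|x| <= 2^-1 -> expR x <= 1 + x + 2 * x ^+ 2.
Proof.
rewrite ler_norml => /andP[x1 x2].
have e1 : 1 - x <= expR (- x) by exact: expR_ge1Dx.
rewrite -[x in expR x]opprK expRN invf_ple ?posrE ?expR_gt0//; last by nra.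
apply: le_trans e1; rewrite -[leLHS]mul1r ler_pdivrMr; last by nra.
nra.
Qed.

Lemma integral_expR_indic A (l : R) : measurable A ->
  (\int[P]_x (expR (l * \1_A x))%:E = (1 + fine (P A) * (expR l - 1))%:E)%E.
Proof.
move=> mA.
under eq_integral => x _.
  rewrite (_ : (expR _)%:E = ((expR l)%:E * (\1_A x)%:E + (\1_(~` A) x)%:E)%E); last first.
    rewrite -EFinM -EFinD !indicE in_setC; case: (x \in A) => /=.
      by rewrite !mulr1 addr0.
    by rewrite !mulr0 expR0 add0r.
  over.
have mC : measurable (~` A) by exact: measurableC.
rewrite ge0_integralD//; last 2 first.
- by apply/measurable_EFinP; apply: measurable_funM => //; exact: measurable_indic.
- by apply/measurable_EFinP; exact: measurable_indic.
rewrite ge0_integralZl ?lee_fin ?expR_ge0//; last first.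
  by apply/measurable_EFinP; exact: measurable_indic.
rewrite !integral_indic// !setIT.
rewrite -[LHS]/((expR l)%:E * P A + P (~` A))%E probability_setC//.
rewrite -[in LHS](@fineK _ (P A)) ?fin_num_measure//.
by rewrite -EFinM -EFinB -EFinD; congr EFin; ring.
Qed.

(** Each factor is [1 + q (e^l - 1)]. Keeping [q] in front of [l^2] is what gives relative accuracy
    far in the tail, where a bound of Hoeffding type would be too coarse. *)
Lemma mgf_hits n A (l : R) : measurable A -> `|l| <= 2^-1 ->
  (\int[iid_law P n]_t (expR (l * hits A t))%:E <=
   (expR (n%:R * fine (P A) * (l + 2 * l ^+ 2)))%:E)%E.
Proof.
move=> mA l2; set q := fine (P A).
have q0 : 0 <= q by rewrite /q fine_ge0.
have mf : measurable_fun setT (fun x => expR (l * \1_A x) : R).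
  by apply: measurableT_comp => //; apply: measurable_funM.
under eq_integral => t _.
  rewrite /hits mulr_sumr expR_sum; over.
rewrite (@integral_iid_prod n _ mf); last by move=> x; exact: expR_ge0.
rewrite integral_expR_indic// -/q.
rewrite (_ : (_ ^+ n)%E = ((1 + q * (expR l - 1)) ^+ n)%:E); last first.
  by elim: n => // n IH; rewrite expeS IH -EFinM exprS.
rewrite lee_fin -mulrA expRM_natl lerXn2r ?nnegrE ?expR_ge0//.
  have := expR_ge0 l; have : q <= 1.
    rewrite -lee_fin fineK ?fin_num_measure//; exact: probability_le1.
  by nra.
apply: le_trans (expR_ge1Dx _); rewrite lerD2l ler_wpM2l//.
by rewrite lerBlDl addrA expR_le1DxDxx.
Qed.

Lemma measurable_hits_ge n A (a : R) : measurable A ->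
  measurable [set t : n.-tuple T | a <= hits A t].
Proof.
move=> mA; have := @measurable_hits n A mA measurableT `[a, +oo[%classic.
rewrite setTI => /(_ (measurable_itv _)); congr measurable.
by apply/seteqP; split => t /=; rewrite in_itv/= andbT.
Qed.

Lemma measurable_hits_le n A (a : R) : measurable A ->
  measurable [set t : n.-tuple T | hits A t <= a].
Proof.
move=> mA; have := @measurable_hits n A mA measurableT `]-oo, a]%classic.
by rewrite setTI => /(_ (measurable_itv _)).
Qed.

Lemma hits_chernoff n A (l s : R) : measurable A -> 0 <= l <= 2^-1 ->
  let q := fine (P A) in
  (iid_law P n [set t | n%:R * q + s <= hits A t]%R <=
     (expR (2 * (n%:R * q) * l ^+ 2 - l * s))%:E)%E /\
  (iid_law P n [set t | hits A t <= n%:R * q - s]%R <=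
     (expR (2 * (n%:R * q) * l ^+ 2 - l * s))%:E)%E.
Proof.
move=> mA /andP[l0 l2] q.
have key (e : R) (B : set (n.-tuple T)) : measurable B -> e ^+ 2 = 1 ->
    (forall t, B t -> 0 <= e * l * (hits A t - n%:R * q) - l * s) ->
    (iid_law P n B <= (expR (2 * (n%:R * q) * l ^+ 2 - l * s))%:E)%E.
  move=> mB e1 hB.
  have ne : `|e| = 1 by apply/eqP; rewrite -(sqrp_eq1 (normr_ge0 e)) real_normK ?num_real// e1.
  have mh : measurable_fun setT (fun t : n.-tuple T => expR (e * l * hits A t) : R).
    by apply: measurableT_comp => //; apply: measurable_funM => //; exact: measurable_hits.
  apply: (@le_trans _ _ (\int[iid_law P n]_t
    ((expR (- (e * l * (n%:R * q)) - l * s))%:E * (expR (e * l * hits A t))%:E))%E).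
    apply: (@measure_le_integral _ _ _ _
      (fun t => expR (- (e * l * (n%:R * q)) - l * s) * expR (e * l * hits A t))) => //.
    - exact: measurable_funM.
    - move=> t /hB h; rewrite -expRD; apply: le_trans (expR_ge1Dx _).
      by rewrite lerDl; lra.
  rewrite ge0_integralZl ?lee_fin ?expR_ge0//; last by apply/measurable_EFinP.
  apply: (le_trans (lee_wpmul2l _ (@mgf_hits n A (e * l) mA _))).
  - by rewrite lee_fin expR_ge0.
  - by rewrite normrM ne mul1r ger0_norm.
  rewrite -EFinM -expRD lee_fin ler_expR -/q.
  rewrite [X in X <= _](_ : _ = 2 * (n%:R * q) * (e ^+ 2 * l ^+ 2) - l * s); last by ring.
  by rewrite e1 mul1r.
split.
- apply: (key 1); rewrite ?expr1n//; first exact: measurable_hits_ge.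
  by move=> t /= h; rewrite mul1r -mulrBr mulr_ge0//; lra.
- apply: (key (-1)); rewrite ?sqrrN ?expr1n//; first exact: measurable_hits_le.
  by move=> t /= h; rewrite mulN1r mulNr -mulrN -mulrBr mulr_ge0//; lra.
Qed.

(** The Bernstein radius, with [l] standing for [L / n]. The factor 3 brings the Chernoff exponent
    below [- L] in both regimes, as [1 / 2 - 3 / 2 = - 1]. *)
Definition deviation (p l : R) : R := 3 * (Num.sqrt (p * l) + l).

Lemma hits_bernstein n A (L : R) : (0 < n)%N -> measurable A -> 0 < L ->
  let q := fine (P A) in
  (iid_law P n [set t | n%:R * (q + deviation q (L / n%:R)) <= hits A t]%R <=
     (expR (- L))%:E)%E /\
  (iid_law P n [set t | hits A t <= n%:R * (q - deviation q (L / n%:R))]%R <=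
     (expR (- L))%:E)%E.
Proof.
move=> n0 mA L0 q; set dv := deviation _ _.
have nR : 0 < n%:R :> R by rewrite ltr0n.
have q0 : 0 <= q by rewrite /q fine_ge0.
suff [l l2 hl] : exists2 l, 0 <= l <= 2^-1 &
    2 * (n%:R * q) * l ^+ 2 - l * (n%:R * dv) <= - L.
  have [h1 h2] := @hits_chernoff n A l (n%:R * dv) mA l2.
  rewrite -/q in h1 h2; rewrite mulrDr mulrBr.
  by split; [apply: le_trans h1 _|apply: le_trans h2 _]; rewrite lee_fin ler_expR.
have ndv : n%:R * dv = 3 * (Num.sqrt (n%:R * q * L) + L).
  rewrite /dv /deviation mulrCA mulrDr (mulrC n%:R (L / _)) divfK ?gt_eqF//.
  congr (_ * (_ + _)).
  rewrite -[X in X * Num.sqrt _](@ger0_norm _ n%:R)// -sqrtr_sqr -sqrtrM ?sqr_ge0//.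
  by congr Num.sqrt; field; rewrite gt_eqF.
rewrite ndv; set m := n%:R * q.
have m0 : 0 <= m by rewrite mulr_ge0// ltW.
(* For an expected count below [L] the largest admissible [l] is taken; otherwise [l] is half of
   [sqrt (L / m)], the order of the minimiser of the exponent. *)
have [mL|Lm] := ltP m L.
  exists 2^-1; first by lra.
  have := sqrtr_ge0 (m * L); nra.
have mp : 0 < m by lra.
set w := Num.sqrt (L / m).
have w0 : 0 <= w by exact: sqrtr_ge0.
have w2 : w ^+ 2 * m = L by rewrite sqr_sqrtr ?divfK ?gt_eqF// divr_ge0 ?ltW.
have sE : Num.sqrt (m * L) = m * w.
  rewrite -w2 [X in Num.sqrt X](_ : _ = (m * w) ^+ 2); last by ring.
  by rewrite sqrtr_sqr ger0_norm// mulr_ge0.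
have w1 : w <= 1.
  by rewrite -[leRHS]sqrtr1 ler_sqrt// ler_pdivrMr// mul1r.
exists (w / 2); first by lra.
rewrite sE; nra.
Qed.

Lemma hits_bernstein_family n m (A : nat -> set T) (L : R) :
    (0 < n)%N -> (forall i, measurable (A i)) -> 0 < L ->
  exists E : set (n.-tuple T), [/\ measurable E,
    (iid_law P n (~` E) <= ((2 * m)%:R * expR (- L))%:E)%E &
    forall t, E t -> forall i, (i < m)%N ->
      `|hits (A i) t / n%:R - fine (P (A i))| <=
        deviation (fine (P (A i))) (L / n%:R)].
Proof.
move=> n0 mA L0.
have nR : 0 < n%:R :> R by rewrite ltr0n.
pose q i := fine (P (A i)).
pose B1 i := [set t : n.-tuple T |
  n%:R * (q i + deviation (q i) (L / n%:R)) <= hits (A i) t].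
pose B2 i := [set t : n.-tuple T |
  hits (A i) t <= n%:R * (q i - deviation (q i) (L / n%:R))].
have mB i : measurable (B1 i `|` B2 i).
  by apply: measurableU; [exact: measurable_hits_ge|exact: measurable_hits_le].
have mBU : measurable (\big[setU/set0]_(i < m) (B1 i `|` B2 i)).
  exact: bigsetU_measurable.
exists (~` \big[setU/set0]_(i < m) (B1 i `|` B2 i)); split.
- exact: measurableC.
- rewrite setCK.
  apply: le_trans (@content_subadditive _ _ _ (iid_law P n) _
    (fun i => B1 i `|` B2 i) m (fun i _ => mB i) mBU (@subset_refl _ _)) _.
  apply: (@le_trans _ _ (\sum_(i < m) (2 * expR (- L))%:E)%E).
    apply: lee_sum => i _.
    apply: le_trans (@measureU2 _ _ _ (iid_law P n) (B1 i) (B2 i) _ _) _.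
    + exact: measurable_hits_ge.
    + exact: measurable_hits_le.
    rewrite mulr2n mulrDl !mul1r EFinD.
    have [h1 h2] := hits_bernstein n0 (mA i) L0.
    exact: leeD.
  by rewrite sumEFin sumr_const card_ord lee_fin -[_ *+ m]mulr_natl natrM mulrA
    (mulrC m%:R).
- move=> t nB i im.
  have {nB} nB : ~ (B1 i `|` B2 i) t.
    by move=> Bt; apply: nB; rewrite -(bigcup_mkord m (fun i => B1 i `|` B2 i)); exists i.
  have [b1 b2] : hits (A i) t < n%:R * (q i + deviation (q i) (L / n%:R)) /\
      n%:R * (q i - deviation (q i) (L / n%:R)) < hits (A i) t.
    by split; rewrite ltNge; apply/negP => b; apply: nB; [left|right].
  rewrite -/(q i) ler_distl; apply/andP; split.
    by rewrite ler_pdivlMr// mulrC ltW.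
  by rewrite ler_pdivrMr// mulrC ltW.
Qed.

Lemma hits_ge0 n (A : set T) (t : n.-tuple T) : 0 <= hits A t :> R.
Proof. by apply: sumr_ge0 => i _; rewrite indicE. Qed.

Lemma le_hits n (A B : set T) (t : n.-tuple T) : A `<=` B ->
  hits A t <= hits B t :> R.
Proof.
move=> AB; apply: ler_sum => i _; rewrite !indicE ler_nat.
case: (boolP (_ \in A)) => // /set_mem At.
by rewrite (mem_set (AB _ At)).
Qed.

End binomial_tail.

Section empirical_tail.
Context {R : realType}.
Implicit Types F : distr_fun R.

Definition law F : probability (measurableTypeR R) R :=
  lebesgue_stieltjes_measure F.

Lemma distr_fun_le F x y : x <= y -> F x <= F y.
Proof. exact: cumulative_is_nondecreasing. Qed.

Lemma law_ray F x :
  law F `]-oo, x]%classic = (F x)%:E.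
Proof. by rewrite -cdf_lebesgue_stieltjes_id /cdf /distribution /pushforward preimage_id. Qed.

Lemma distr_fun_ge0 F x : 0 <= F x.
Proof. by rewrite -lee_fin -law_ray. Qed.

Lemma distr_fun_le1 F x : F x <= 1.
Proof. by rewrite -lee_fin -law_ray probability_le1. Qed.

Lemma law_tail F x :
  law F `]x, +oo[%classic = (1 - F x)%:E.
Proof.
rewrite -setCitvl.
by rewrite probability_setC// law_ray.
Qed.

(** Continuity from below along closed rays ending before [z], where [F] may jump. *)
Lemma law_left_ray F z (c : R) : (forall y, y < z -> F y <= c) ->
  (law F `]-oo, z[%classic <= c%:E)%E.
Proof.
move=> Fc.
have zE : `]-oo, z[%classic = \bigcup_n (`]-oo, z - n.+1%:R^-1]%classic : set R).
  apply/seteqP; split => [y|y [n _]] /=; rewrite !in_itv/=.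
    move=> yz; have zy : 0 < z - y by lra.
    exists (Num.truncn (z - y)^-1) => //=; rewrite in_itv/=.
    have h : (Num.truncn (z - y)^-1).+1%:R^-1 < z - y.
      by rewrite invf_plt ?posrE// truncnS_gt.
    by rewrite lerBrDr -lerBrDl ltW.
  by move=> /le_lt_trans; apply; rewrite ltrBlDr ltrDl.
have : law F `]-oo, z - n.+1%:R^-1]%classic @[n --> \oo] -->
    law F (\bigcup_n `]-oo, z - n.+1%:R^-1]%classic).
  apply: nondecreasing_cvg_mu => //; first exact: bigcup_measurable.
  move=> i j ij; apply/subsetPset/subset_itv => //=.
  by rewrite bnd_simp lerD2l lerN2 lef_pV2 ?posrE// ler_nat.
rewrite -zE => h.
rewrite -(cvg_lim _ h)//; apply: lime_le; first by apply/cvg_ex; eexists; exact: h.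
near=> n; rewrite law_ray lee_fin; apply: Fc.
by rewrite ltrBlDr ltrDl.
Unshelve. all: by end_near. Qed.

Lemma law_closed_tail F z (c : R) : (forall y, y < z -> F y <= c) ->
  ((1 - c)%:E <= law F `[z, +oo[%classic)%E.
Proof.
move=> /law_left_ray; rewrite -setCitvl.
move=> h; rewrite probability_setC// EFinB; exact: leeB.
Qed.

Lemma distr_fun_quantile F (c : R) : 0 < c < 1 ->
  exists z, c <= F z /\ forall y, y < z -> F y < c.
Proof.
move=> /andP[c0 c1].
have [a Fa] : exists a, F a < c.
  have /cvgrPdist_lt/(_ c c0)[a [_ ha]] := cumulativeNy F.
  exists (a - 1); have := ha (a - 1); rewrite sub0r normrN.
  by move=> /(_ ltac:(lra)); apply: le_lt_trans; exact: ler_norm.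
have [b Fb] : exists b, c <= F b.
  have c1' : 0 < 1 - c by lra.
  have /cvgrPdist_lt/(_ _ c1')[b [_ hb]] := cumulativey F.
  exists (b + 1); have := hb (b + 1); move=> /(_ ltac:(lra)).
  by have := ler_norm (1 - F (b + 1)); lra.
pose S := [set x | c <= F x].
have lS : has_lbound S.
  exists a => x; rewrite /S/= => cFx; rewrite leNgt; apply/negP => xa.
  by have := distr_fun_le F (ltW xa); lra.
exists (inf S); split.
  rewrite leNgt; apply/negP => Fz.
  have e0 : 0 < (c - F (inf S)) / 2 by lra.
  have [d hd] := nondecreasing_right_continuousP (inf S) F e0.
  have [y Sy yd] : exists2 y, S y & y < inf S + d%:num.
    by apply: inf_adherent => //; split => //; exists b.
  have hd' : F (inf S + d%:num) <= F (inf S) + (c - F (inf S)) / 2 by exact: hd.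
  have hy := distr_fun_le F (ltW yd); rewrite /S /= in Sy; lra.
move=> y yz; rewrite ltNge; apply/negP => Sy.
by have := ge_inf lS Sy; lra.
Qed.

Definition tail_count n (x : R) (t : n.-tuple (measurableTypeR R)) : R :=
  hits R `]x, +oo[ t.

(** The 3 of [deviation] becomes 7: bracketing by quantiles changes masses by at most [1 / n <= l],
    which adds [3 l] through the square root and [l] outside it. *)
Definition tail_close n (l : R) F x (t : n.-tuple (measurableTypeR R)) : Prop :=
  `|tail_count x t / n%:R - (1 - F x)| <= 7 * (Num.sqrt ((1 - F x) * l) + l).

Lemma sqrtr_mulDl_le (p l : R) : 0 <= p -> 0 <= l ->
  Num.sqrt ((p + l) * l) <= Num.sqrt (p * l) + l.
Proof.
move=> p0 l0; rewrite -(ler_pXn2r (n := 2))// ?nnegrE ?addr_ge0 ?sqrtr_ge0//.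
rewrite sqrrD !sqr_sqrtr ?mulr_ge0 ?addr_ge0//.
have := mulr_ge0 (sqrtr_ge0 (p * l)) l0; nra.
Qed.

(* F-quantiles at levels k/n bracket every open tail between two tails of the
   finite family whose masses differ by at most 1/n. *)
Lemma tail_close_uniform n (L : R) F : (0 < n)%N -> 1 <= L ->
  exists E : set (n.-tuple (measurableTypeR R)), [/\ measurable E,
    (iid_law (law F) n (~` E) <= ((4 * n)%:R * expR (- L))%:E)%E &
    forall t, E t -> forall x, tail_close (L / n%:R) F x t].
Proof.
move=> n0 L1.
have nR : 0 < n%:R :> R by rewrite ltr0n.
have /choice[z hz] : forall k, exists z, (0 < k < n)%N ->
    k%:R / n%:R <= F z /\ forall y, y < z -> F y < k%:R / n%:R.
  move=> k; case: (boolP (0 < k < n)%N) => [/andP[k0 kn]|_]; last by exists 0.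
  have [|z hz] := @distr_fun_quantile F (k%:R / n%:R); last by exists z.
  by rewrite divr_gt0 ?ltr0n//= ltr_pdivrMr// mul1r ltr_nat.
(* Open tails first, then closed ones. [F] may jump at a quantile: the outer bracket needs the open
   tail, of mass at most [1 - k / n], the inner one the closed tail, of mass at least that. *)
pose A i : set (measurableTypeR R) :=
  if (i < n)%N then `]z i, +oo[%classic else `[z (i - n)%N, +oo[%classic.
have mA i : measurable (A i) by rewrite /A; case: ifP => _; exact: measurable_itv.
have [|E [mE PE hE]] := hits_bernstein_family (law F) (2 * n) n0 mA (L := L).
  by lra.
exists E; split => //; first by rewrite [(4 * n)%N](_ : _ = (2 * (2 * n))%N)// mulnA.
move=> t Et x; set l := L / n%:R.
have ln : n%:R^-1 <= l by rewrite /l ler_pdivlMr// mulVf ?gt_eqF.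
have l0 : 0 <= l by apply: le_trans ln; rewrite invr_ge0 ltW.
have p0 : 0 <= 1 - F x by rewrite subr_ge0 distr_fun_le1.
have [p pE] : exists p, p = 1 - F x by exists (1 - F x).
rewrite -pE in p0; set s := Num.sqrt (p * l).
have s0 : 0 <= s by exact: sqrtr_ge0.
(* Capped at [n - 1] because [F x = 1] is possible. At either end one bracket is missing, and there
   the trivial bounds 0 and 1 on the frequency suffice. *)
pose k := minn (Num.truncn (n%:R * F x)) n.-1.
have kF : k%:R / n%:R <= F x.
  rewrite ler_pdivrMr// mulrC.
  apply: (@le_trans _ _ (Num.truncn (n%:R * F x))%:R).
    by rewrite ler_nat geq_minl.
  by rewrite truncn_le// mulr_ge0// distr_fun_ge0.
have kE : k = Num.truncn (n%:R * F x) \/ k.+1 = n.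
  rewrite /k; have [h|h] := leqP (Num.truncn (n%:R * F x)) n.-1.
    by left.
  by right; rewrite prednK.
have Fk : F x <= k.+1%:R / n%:R.
  rewrite ler_pdivlMr// mulrC; case: kE => ->; first exact/ltW/truncnS_gt.
  by rewrite ler_piMr ?distr_fun_le1.
have kn : (k < n)%N by rewrite /k gtn_min prednK// leqnn orbT.
have Fk' : (k.+1 < n)%N -> F x < k.+1%:R / n%:R.
  rewrite ltr_pdivlMr// mulrC; case: kE => ->; last by rewrite ltnn.
  by move=> _; exact/truncnS_gt.
have Dk : k.+1%:R / n%:R = k%:R / n%:R + n%:R^-1 :> R by rewrite -natr1 mulrDl mul1r.
have dvl q : deviation q l = 3 * (Num.sqrt (q * l) + l) by [].
rewrite /tail_close -pE -/s /tail_count ler_distl; apply/andP; split.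
- have [kn1|nk] := ltnP k.+1 n.
  + have [_ z2] := hz k.+1 kn1; have [z1 _] := hz k.+1 kn1.
    have AE : A (n + k.+1)%N = `[z k.+1, +oo[%classic.
      by rewrite /A ltnNge leq_addr/= addKn.
    have xz : x < z k.+1.
      by rewrite ltNge; apply/negP => /(distr_fun_le F); have := Fk' kn1; lra.
    have sub : A (n + k.+1)%N `<=` `]x, +oo[%classic.
      by rewrite AE; apply: subset_itvr; rewrite bnd_simp.
    have q1 : p - l <= fine (law F (A (n + k.+1)%N)).
      rewrite -lee_fin fineK ?fin_num_measure// AE.
      apply: le_trans (law_closed_tail (fun y yz => ltW (z2 y yz))).
      by rewrite lee_fin; lra.
    have q2 : fine (law F (A (n + k.+1)%N)) <= p.
      rewrite -lee_fin fineK ?fin_num_measure// pE -law_tail.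
      by apply: le_measure; rewrite ?inE//; exact: mA.
    have iA : (n + k.+1 < 2 * n)%N by rewrite mul2n -addnn ltn_add2l.
    have := hE t Et (n + k.+1)%N iA; rewrite ler_distl => /andP[+ _].
    have : hits R (A (n + k.+1)%N) t / n%:R <= hits R `]x, +oo[%classic t / n%:R.
      by rewrite ler_pM2r ?invr_gt0//; exact: le_hits.
    have : Num.sqrt (fine (law F (A (n + k.+1)%N)) * l) <= s.
      by rewrite ler_wsqrtr// ler_wpM2r.
    rewrite -/l dvl; lra.
  + have : 0 <= hits R `]x, +oo[%classic t / n%:R by rewrite divr_ge0 ?hits_ge0// ltW.
    have : k.+1%:R / n%:R >= 1 :> R by rewrite ler_pdivlMr// mul1r ler_nat.
    by lra.
- have [k0|k0] := posnP k.
  + have : hits R `]x, +oo[%classic t / n%:R <= 1 :> R.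
      rewrite ler_pdivrMr// mul1r /hits.
      apply: (@le_trans _ _ (\sum_(i < n) 1)); last by rewrite sumr_const card_ord.
      by apply: ler_sum => i _; rewrite indicE lern1; case: (_ \in _).
    rewrite k0 in Dk Fk; lra.
  + have kk : (0 < k < n)%N by rewrite k0 kn.
    have [z1 z2] := hz k kk.
    have AE : A k = `]z k, +oo[%classic by rewrite /A kn.
    have zx : z k <= x by rewrite leNgt; apply/negP => /z2; lra.
    have sub : `]x, +oo[%classic `<=` A k.
      by rewrite AE; apply: subset_itvr; rewrite bnd_simp.
    have qE : fine (law F (A k)) = 1 - F (z k) by rewrite AE law_tail.
    have q0 : 0 <= 1 - F (z k) by rewrite subr_ge0 distr_fun_le1.
    have qp : 1 - F (z k) <= p + l by lra.
    have iA : (k < 2 * n)%N by rewrite mul2n -addnn ltn_addl.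
    have := hE t Et k iA; rewrite ler_distl => /andP[_].
    have : hits R `]x, +oo[%classic t / n%:R <= hits R (A k) t / n%:R.
      by rewrite ler_pM2r ?invr_gt0//; exact: le_hits.
    have : Num.sqrt ((1 - F (z k)) * l) <= s + l.
      by apply: le_trans (sqrtr_mulDl_le p0 l0); rewrite ler_wsqrtr// ler_wpM2r.
    rewrite -/l dvl qE; lra.
Qed.

Definition typical n (L M K : R) F (tau : R)
    (t : n.-tuple (measurableTypeR R)) : Prop :=
  (forall x, tail_close (L / n%:R) F x t) /\
  (forall j : nat, `|j%:R - K / tau| <= 3 -> tail_close (M / n%:R) F (expR j%:R) t).

Lemma typical_event n (L M K tau : R) F : (0 < n)%N -> 1 <= L -> 0 < M ->
    0 <= K / tau ->
  exists E : set (n.-tuple (measurableTypeR R)), [/\ measurable E,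
    (iid_law (law F) n (~` E) <=
      ((4 * n)%:R * expR (- L) + 14%:R * expR (- M))%:E)%E &
    forall t, E t -> typical L M K F tau t].
Proof.
move=> n0 L1 M0 K0.
have [E1 [mE1 PE1 hE1]] := tail_close_uniform F n0 L1.
(* Integers within 3 of [K / tau] are within 3 of its floor, hence seven candidates and, with two
   tails each, the factor 14. Near 0 the truncated subtraction only repeats a point. *)
pose A i : set (measurableTypeR R) :=
  `]expR (Num.truncn (K / tau) + i - 3)%:R, +oo[%classic.
have mA i : measurable (A i) by exact: measurable_itv.
have [E2 [mE2 PE2 hE2]] := hits_bernstein_family (law F) 7 n0 mA M0.
exists (E1 `&` E2); split; first exact: measurableI.
- rewrite setCI EFinD; apply: le_trans (measureU2 _ _ _) (leeD PE1 PE2).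
  + exact: measurableC.
  + exact: measurableC.
- move=> t [E1t E2t]; split; first exact: hE1.
  move=> j; rewrite ler_distl => /andP[j1 j2].
  have := truncn_itv K0 => /andP[f1 f2].
  have jf : (j <= Num.truncn (K / tau) + 3)%N.
    by rewrite -ltnS -(ltr_nat R) -addn1 !natrD; move: f2; rewrite -natr1; lra.
  have fj : (Num.truncn (K / tau) <= j + 3)%N.
    by rewrite -(ler_nat R) natrD; lra.
  have i7 : (j + 3 - Num.truncn (K / tau) < 7)%N.
    by move: jf; clear; lia.
  have := hE2 t E2t _ i7.
  rewrite /A subnKC// addnK law_tail /=.
  rewrite /tail_close /tail_count => /le_trans; apply.
  rewrite /deviation ler_wpM2r ?ler_nat// addr_ge0 ?sqrtr_ge0//.
  by rewrite divr_ge0// ltW.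
Qed.

End empirical_tail.

(** * Tests depending on finitely many comparisons *)

Section configuration.
Context {R : realType} (n : nat).
Local Notation sample := (n.-tuple (measurableTypeR R)).

Lemma measurable_bool_ffun d (T : measurableType d) (I : finType)
    (c : T -> {ffun I -> bool}) (B : set {ffun I -> bool}) :
  (forall i, measurable [set t | c t i]) -> measurable (c @^-1` B).
Proof.
move=> mc.
have m1 f : measurable (c @^-1` [set f]).
  rewrite (_ : _ @^-1` _ = \bigcap_(i in [set: I]) [set t | c t i = f i]).
    apply: fin_bigcap_measurable => // i _; case: (f i); first exact: mc.
    rewrite (_ : [set _ | _] = ~` [set t | c t i]); first exact: measurableC.
    by apply/seteqP; split => t /=; case: (c t i).
  apply/seteqP; split => [t /= <- //|t /= h].
  by apply/ffunP => i; exact: h.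
rewrite (_ : c @^-1` B = \bigcup_(f in B) (c @^-1` [set f])).
  by apply: fin_bigcup_measurable => //; exact: finite_finset.
by apply/seteqP; split => [t Bt|t [f Bf /= ->]//]; exists (c t).
Qed.

(** Mesh [1 / n] in [log x], from [e^-n] to [e^n] as [i] runs up to [2 n^2]. Moving by one cell
    changes a power tail by a factor [1 + O(1 / n)] only. *)
Definition grid (i : nat) : R := expR (i%:R / n%:R - n%:R).

Definition comparison := (('I_n * 'I_n) + ('I_n * 'I_(2 * n * n).+1))%type.

Definition config (t : sample) : {ffun comparison -> bool} :=
  [ffun c : comparison => match c with
             | inl (i, j) => tnth t i <= tnth t j
             | inr (i, k) => tnth t i <= grid k
             end].

Lemma measurable_config B : measurable (config @^-1` B).
Proof.
apply: measurable_bool_ffun => -[[i j]|[i k]].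
- rewrite (_ : [set _ | _] =
      (fun t : sample => tnth t j - tnth t i : R) @^-1` `[0, +oo[).
    rewrite -[X in measurable X]setTI.
    apply: (measurable_funB (measurable_tnth j) (measurable_tnth i)) => //.
  by apply/seteqP; split => t /=; rewrite ffunE in_itv/= andbT subr_ge0.
- rewrite (_ : [set _ | _] = (fun t : sample => tnth t i) @^-1` `]-oo, grid k]).
    by rewrite -[X in measurable X]setTI; exact: measurable_tnth.
  by apply/seteqP; split => t /=; rewrite ffunE in_itv.
Qed.

Lemma eq_tail_count (t t' : sample) (x x' : R) :
  (forall i, (tnth t i <= x) = (tnth t' i <= x')) ->
  tail_count x t = tail_count x' t'.
Proof.
move=> h; rewrite /tail_count /hits; apply: eq_bigr => i _.
rewrite !indicE; congr (nat_of_bool _)%:R; apply/idP/idP.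
  by move=> /set_mem/=; rewrite in_itv/= andbT => xt; rewrite inE/= in_itv/= andbT ltNge -h -ltNge.
by move=> /set_mem/=; rewrite in_itv/= andbT => xt; rewrite inE/= in_itv/= andbT ltNge h -ltNge.
Qed.

Lemma config_grid (t t' : sample) i k : config t = config t' -> (k <= 2 * n * n)%N ->
  (tnth t i <= grid k) = (tnth t' i <= grid k).
Proof.
move=> /ffunP tt' kn; rewrite -ltnS in kn.
by have := tt' (inr (i, Ordinal kn)); rewrite !ffunE.
Qed.

Lemma config_tail_grid (t t' : sample) k : config t = config t' ->
  (k <= 2 * n * n)%N -> tail_count (grid k) t = tail_count (grid k) t'.
Proof. by move=> tt' kn; apply: eq_tail_count => i; exact: config_grid. Qed.

(** The integer points [e^j] are grid points, so counts transport there without moving [x]; the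
    estimates of [tau] and [C] rely on this. *)
Lemma gridK (j : nat) : (0 < n)%N -> grid (n * (j + n)) = expR j%:R.
Proof.
move=> n0; rewrite /grid natrM natrD mulrC mulKf ?addrK//.
by rewrite pnatr_eq0 -lt0n.
Qed.

Lemma config_tail_nat (t t' : sample) (j : nat) : (0 < n)%N ->
    config t = config t' -> (j <= n)%N ->
  tail_count (expR j%:R) t = tail_count (expR j%:R) t'.
Proof. by move=> n0 tt' jn; rewrite -gridK//; apply: config_tail_grid => //; nia. Qed.

(* Between two grid points, the tail count of [t] at [x] is the one at the
   largest observation below [x], whose rank and cell are seen by [config]. *)
Lemma config_tail (t t' : sample) (y : R) : (0 < n)%N -> config t = config t' ->
    - n%:R <= y < n%:R ->
  exists2 y', `|y - y'| <= n%:R^-1 & tail_count (expR y) t = tail_count (expR y') t'.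
Proof.
move=> n0 tt' /andP[yn1 yn2].
have nR : 0 < n%:R :> R by rewrite ltr0n.
have z0 : 0 <= n%:R * (y + n%:R) by rewrite mulr_ge0//; lra.
pose k := Num.truncn (n%:R * (y + n%:R)).
have := truncn_itv z0; rewrite -/k => /andP[k1 k2].
have k1' : k%:R / n%:R - n%:R <= y.
  by rewrite lerBlDr ler_pdivrMr// mulrC.
have k2' : y < k.+1%:R / n%:R - n%:R.
  by rewrite ltrBrDr ltr_pdivlMr// mulrC.
have kS : k.+1%:R / n%:R = k%:R / n%:R + n%:R^-1 :> R by rewrite -natr1 mulrDl mul1r.
rewrite kS in k2'.
have kn : (k < 2 * n * n)%N.
  rewrite -(ltr_nat R) !natrM; apply: (le_lt_trans k1).
  have : n%:R * y < n%:R * n%:R by rewrite ltr_pM2l.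
  lra.
pose below i := (grid k < tnth t i) && (tnth t i <= expR y).
have [[i0 i0y]|none] := pselect (exists i, below i); last first.
  exists (k%:R / n%:R - n%:R).
    by move: k1' k2'; set w := k%:R / n%:R; rewrite ler_norml; lra.
  rewrite -/(grid k) -(config_tail_grid tt' (ltnW kn)).
  apply: eq_tail_count => i; apply/idP/idP => h.
    rewrite leNgt; apply/negP => h'; apply: none; exists i.
    by rewrite /below h'.
  by apply: le_trans h _; rewrite ler_expR.
case: (arg_maxP (fun i => tnth t i : R) i0y) => i /andP[iy1 iy2] imax.
have i'1 : grid k < tnth t' i.
  by rewrite ltNge -(config_grid i tt' (ltnW kn)) -ltNge.
have i'2 : tnth t' i <= grid k.+1.
  by rewrite -(config_grid i tt' kn) (le_trans iy2)// ler_expR kS ltW.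
have ti0 : 0 < tnth t' i by apply: lt_trans i'1; exact: expR_gt0.
exists (ln (tnth t' i)).
  have : k%:R / n%:R - n%:R < ln (tnth t' i) by rewrite -ltr_expR lnK.
  have : ln (tnth t' i) <= k%:R / n%:R + n%:R^-1 - n%:R by rewrite -kS -ler_expR lnK.
  move: k1' k2'; set w := k%:R / n%:R.
  by rewrite ler_norml; lra.
rewrite lnK//; apply: eq_tail_count => m.
have <- : (tnth t m <= tnth t i) = (tnth t' m <= tnth t' i).
  by have /ffunP/(_ (inl (m, i))) := tt'; rewrite !ffunE.
apply/idP/idP => [h|h]; last exact: le_trans h iy2.
have [mk|km] := leP (tnth t m) (grid k); first exact: le_trans mk (ltW iy1).
by apply: imax; rewrite /below km.
Qed.

End configuration.

(** * From a shared table to a relation between two distributions, and the test *)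

Section coupling.
Context {R : realType}.
Implicit Types (F : distr_fun R) (tau l : R).

Definition near_tail F0 F1 l x0 x1 : Prop :=
  `|F1 x1 - F0 x0| <= 161%:R * (Num.sqrt ((1 - F1 x1) * l) + l).

(* The hypothesis gives |sqrt p0 - sqrt p1| <= 21 sqrt l, and 161 = 7 * 21 + 14. *)
Lemma sqrt_deviation (p0 p1 l : R) : 0 <= p0 -> 0 <= p1 -> 0 <= l ->
  `|p0 - p1| <= 7 * (Num.sqrt (p0 * l) + l) + 7 * (Num.sqrt (p1 * l) + l) ->
  `|p0 - p1| <= 161%:R * (Num.sqrt (p1 * l) + l).
Proof.
move=> p00 p10 l0; rewrite !sqrtrM//.
rewrite -[in X in X -> _](sqr_sqrtr p00) -[in X in X -> _](sqr_sqrtr p10).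
rewrite -[p0 in X in _ -> X](sqr_sqrtr p00) -[p1 in X in _ -> X](sqr_sqrtr p10).
rewrite !sqrtr_sqr !(ger0_norm (sqrtr_ge0 _)).
rewrite -[in X in X -> _](sqr_sqrtr l0) -[in X in _ -> X](sqr_sqrtr l0).
rewrite !sqrtr_sqr !(ger0_norm (sqrtr_ge0 _)).
have := sqrtr_ge0 p0; have := sqrtr_ge0 p1; have := sqrtr_ge0 l.
move: (Num.sqrt p0) (Num.sqrt p1) (Num.sqrt l) => a b s s0 b0 a0.
have -> : a ^+ 2 - b ^+ 2 = (a - b) * (a + b) by ring.
move=> h.
have ab : `|a - b| <= 21%:R * s.
  have [sab|sab] := leP (a + b) s; first by rewrite ler_norml; lra.
  rewrite leNgt; apply/negP => ab.
  move: h; rewrite normrM [X in _ * X]ger0_norm ?addr_ge0//.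
  by move: ab; set X := `|a - b|; nra.
apply: le_trans h _.
move: ab; rewrite ler_norml => /andP[_ ab]; nra.
Qed.

Lemma near_tail_of_close n l F0 F1 x0 x1 (t0 t1 : n.-tuple (measurableTypeR R)) :
    0 <= l -> tail_count x1 t1 = tail_count x0 t0 ->
    tail_close l F0 x0 t0 -> tail_close l F1 x1 t1 ->
  near_tail F0 F1 l x0 x1.
Proof.
move=> l0 tt; rewrite /tail_close tt /near_tail => h0 h1.
have -> : F1 x1 - F0 x0 = (1 - F0 x0) - (1 - F1 x1) by lra.
apply: sqrt_deviation; rewrite ?subr_ge0 ?distr_fun_le1//.
move: h0 h1; rewrite !ler_norml; lra.
Qed.

(** Three precisions: every [y], up to a shift by [1 / n]; integer points, without shift; and the
    sharper level [M] where both windows contain the point, each sample being controlled on the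
    window of its own parameter. *)
Definition coupled n (L M K : R) F0 F1 tau0 tau1 : Prop :=
  [/\ forall y, - n%:R <= y < n%:R -> exists2 y', `|y - y'| <= n%:R^-1 &
        near_tail F0 F1 (L / n%:R) (expR y') (expR y),
      forall j : nat, (j <= n)%N ->
        near_tail F0 F1 (L / n%:R) (expR j%:R) (expR j%:R) &
      forall j : nat, (j <= n)%N -> `|j%:R - K / tau0| <= 3 ->
        `|j%:R - K / tau1| <= 3 ->
        near_tail F0 F1 (M / n%:R) (expR j%:R) (expR j%:R)].

Lemma typical_coupled n L M K F0 F1 tau0 tau1 (t0 t1 : n.-tuple (measurableTypeR R)) :
    (0 < n)%N -> 0 <= L -> 0 <= M -> config t1 = config t0 ->
    typical L M K F0 tau0 t0 -> typical L M K F1 tau1 t1 ->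
  coupled n L M K F0 F1 tau0 tau1.
Proof.
move=> n0 L0 M0 tt [h0 h0'] [h1 h1'].
have Ln : 0 <= L / n%:R by rewrite divr_ge0.
have Mn : 0 <= M / n%:R by rewrite divr_ge0.
split.
- move=> y /(config_tail n0 tt)[y' yy' e]; exists y' => //.
  exact: near_tail_of_close Ln e (h0 _) (h1 _).
- move=> j jn.
  exact: near_tail_of_close Ln (config_tail_nat n0 tt jn) (h0 _) (h1 _).
- move=> j jn j0 j1.
  exact: near_tail_of_close Mn (config_tail_nat n0 tt jn) (h0' _ j0) (h1' _ j1).
Qed.

(** The test rejects unless the table of the sample is that of some sample typical for a pair of
    [S0]. Under [S0], rejection makes the sample atypical; under [S1], accepting a typical sample
    would produce a coupled pair. Pairs carry [tau] because it positions the window of [typical]. *)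
Lemma test_of_uncoupled n L M K (S0 S1 : set (distr_fun R * R)) :
    (0 < n)%N -> 1 <= L -> 0 < M -> 0 <= K ->
    (forall s, S0 s \/ S1 s -> 0 < s.2) ->
    (forall s0 s1, S0 s0 -> S1 s1 -> ~ coupled n L M K s0.1 s1.1 s0.2 s1.2) ->
  exists Psi : test R n,
    let bound := ((4 * n)%:R * expR (- L) + 14%:R * expR (- M))%:E in
    (forall s, S0 s -> (expect s.1 (fun t => (Psi t)%:R%R) <= bound)%E) /\
    (forall s, S1 s -> (expect s.1 (fun t => 1 - (Psi t)%:R)%R <= bound)%E).
Proof.
move=> n0 L1 M0 K0 S_gt0 S01.
pose acc := [set c | exists s t,
  [/\ S0 s, config t = c & typical (n := n) L M K s.1 s.2 t]].
pose A := @config R n @^-1` acc.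
have mA : measurable A by exact: measurable_config.
have mPsi : measurable_fun setT (fun t : n.-tuple (measurableTypeR R) => t \notin A).
  apply: (measurable_fun_bool false); rewrite setTI.
  rewrite (_ : _ @^-1` _ = A)//; apply/seteqP; split => t /=.
    by move=> /negbFE /set_mem.
  by move=> /mem_set ->.
pose Psi : test R n := HB.pack (fun t : n.-tuple (measurableTypeR R) => t \notin A)
  (isMeasurableFun.Build _ _ _ _ _ mPsi).
have K_ge0 s : S0 s \/ S1 s -> 0 <= K / s.2.
  by move=> /S_gt0 s0; rewrite divr_ge0// ltW.
have L0 : 0 <= L by lra.
exists Psi; split => s Ss.
- have [E [mE PE hE]] := typical_event s.1 n0 L1 M0 (K_ge0 s (or_introl Ss)).
  apply: le_trans PE; rewrite /expect.
  rewrite (_ : (fun t => (Psi t)%:R) = \1_(~` A)); last first.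
    by apply/funext => t; rewrite indicE in_setC.
  rewrite expectation_indic; last exact: measurableC.
  apply: le_measure; rewrite ?inE; [exact: measurableC|exact: measurableC|].
  by apply: subsetC => t /hE ht; exists s, t.
- have [E [mE PE hE]] := typical_event s.1 n0 L1 M0 (K_ge0 s (or_intror Ss)).
  apply: le_trans PE; rewrite /expect.
  rewrite (_ : (fun t => 1 - (Psi t)%:R) = \1_A); last first.
    apply/funext => t; rewrite indicE /=.
    by case: (t \in A); rewrite ?subr0 ?subrr.
  rewrite expectation_indic//.
  apply: le_measure; rewrite ?inE; [exact: mA|exact: measurableC|].
  move=> t [s0 [t0 [S0s0 tt0 h0]]] /hE h1.
  by apply: (S01 s0 s S0s0 Ss); exact: typical_coupled (ltW M0) (esym tt0) h0 h1.
Qed.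

End coupling.

(** * Projections onto the tail classes *)

Section distribution_functions.
Context {R : realType}.
Implicit Types (F G : distr_fun R) (f : R -> R) (tau b C e x : R).

Lemma distr_fun_near1 F (c : R) : c < 1 ->
  exists a, forall x, a <= x -> c <= F x.
Proof.
move=> c1; have c1' : 0 < 1 - c by lra.
have /cvgrPdist_lt/(_ _ c1')[a [_ ha]] := cumulativey F.
exists (a + 1) => x ax; have := ha x ltac:(lra).
by have := ler_norm (1 - F x); lra.
Qed.

Lemma distr_fun_right F x (e : R) : 0 < e -> exists2 y, x < y & F y <= F x + e.
Proof.
move=> e0; have [d hd] := nondecreasing_right_continuousP x F e0.
by exists (x + d%:num) => //; rewrite ltrDl.
Qed.

Lemma distr_fun_of f :
    {homo f : x y / x <= y} -> (forall x e, 0 < e -> exists2 y, x < y & f y <= f x + e) ->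
    (forall x, x < 0 -> f x = 0) -> (forall x, f x <= 1) ->
    (forall e, 0 < e -> exists x, 1 - e <= f x) ->
  exists F, forall x, F x = f x.
Proof.
move=> f_nd f_rc f_neg f_le1 f_near1.
have rc : forall x, f @ at_right x --> f x.
  move=> x; apply/cvgrPdist_le => e e0; have [y xy fy] := f_rc x e e0.
  near=> z; have xz : x < z by near: z; exact: nbhs_right_gt.
  have zy : z < y by near: z; exact: nbhs_right_lt.
  have := f_nd _ _ (ltW xz); have := f_nd _ _ (ltW zy).
  by rewrite ler_norml; lra.
have fNy : f x @[x --> -oo] --> (0 : R).
  apply/cvgrPdist_le => e e0; near=> x.
  have x0 : x < 0 by near: x; exact: nbhs_ninfty_lt.
  by rewrite f_neg// subrr normr0 ltW.
have fy : f x @[x --> +oo] --> (1 : R).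
  apply/cvgrPdist_le => e e0; have [a fa] := f_near1 e e0.
  near=> x; have ax : a <= x by near: x; apply: nbhs_pinfty_ge; rewrite num_real.
  by have := f_nd _ _ ax; have := f_le1 x; rewrite ler_norml; lra.
pose F : distr_fun R := HB.pack f (isCumulative.Build R _ R f f_nd rc)
  (isCumulativeBounded.Build R 0 1 f fNy fy).
by exists F.
Unshelve. all: end_near. Qed.

Lemma expR_powRN (x a : R) : 0 < x -> x `^ (- a) = expR (- (a * ln x)).
Proof. by move=> x0; rewrite /powR gt_eqF// mulNr. Qed.

Lemma ler_powRN (a x y : R) : 0 <= a -> 0 < x -> x <= y -> y `^ (- a) <= x `^ (- a).
Proof.
move=> a0 x0 xy; have y0 : 0 < y by exact: lt_le_trans xy.
by rewrite !expR_powRN// ler_expR lerN2 ler_wpM2l// ler_ln ?posrE.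
Qed.

Lemma powRN_right (a c x e : R) : 0 <= a -> 0 <= c -> 0 < x -> 0 < e ->
  exists2 y, x < y & c * x `^ (- a) - e <= c * y `^ (- a).
Proof.
move=> a0 c0 x0 e0.
have m0 : 0 <= c * x `^ (- a) by rewrite mulr_ge0 ?powR_ge0.
pose m := c * x `^ (- a); pose d := e / (m * a + 1).
have ma0 : 0 < m * a + 1 by rewrite ltr_wpDl// mulr_ge0.
have d0 : 0 < d by rewrite divr_gt0.
exists (x * expR d); first by rewrite ltr_pMr// expR_gt1.
rewrite [(_ * _) `^ _]expR_powRN ?mulr_gt0 ?expR_gt0// lnM ?posrE ?expR_gt0// expRK.
rewrite mulrDr opprD expRD -expR_powRN// mulrA -/m.
have := expR_ge1Dx (- (a * d)).
have : m * a * d <= e.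
  rewrite /d mulrA ler_pdivrMr//; nra.
move: m0; rewrite -/m; nra.
Qed.

Lemma powRN_small (a c e : R) : 0 < a -> 0 <= c -> 0 < e ->
  exists X, forall x, X <= x -> 0 < x /\ c * x `^ (- a) <= e.
Proof.
move=> a0 c0 e0; exists (expR (c / (e * a))) => x Xx.
have x0 : 0 < x by apply: lt_le_trans Xx; exact: expR_gt0.
split => //; rewrite expR_powRN// expRN ler_pdivrMr ?expR_gt0//.
have lx : c / (e * a) <= ln x by rewrite -ler_expR lnK.
have := expR_ge1Dx (a * ln x).
have : c <= e * (a * ln x).
  by rewrite mulrA mulrC -ler_pdivrMr// mulr_gt0.
nra.
Qed.

Lemma powR_mulVN (x a : R) : 0 < x -> x `^ a * x `^ (- a) = 1.
Proof. by move=> x0; rewrite powRN divff// gt_eqF// powR_gt0. Qed.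

Lemma tail_dist_le tau e F G : 0 < tau -> 0 <= e -> nneg_supported F ->
    (forall x, 0 < x -> 0 < F x < 1 -> `|F x - G x| <= e * x `^ (- tau)) ->
  (tail_dist tau F G <= e%:E)%E.
Proof.
move=> tau0 e0 Fneg FG; apply: ge_ereal_sup => _ [x /= Fx <-]; rewrite lee_fin.
rewrite -mulrBr normrM ger0_norm ?powR_ge0//.
have -> : (1 - F x) - (1 - G x) = - (F x - G x) by lra.
rewrite normrN.
(* An atom at 0 is allowed, but the weight vanishes there. *)
have [x0|x0] := ltP 0 x; last first.
  have -> : x = 0.
    apply/eqP; rewrite eq_le x0/= leNgt; apply/negP => /Fneg Fx0.
    by rewrite Fx0 ltxx in Fx.
  by rewrite powR0 ?mul0r// gt_eqF.
apply: (le_trans (ler_wpM2l (powR_ge0 _ _) (FG x x0 Fx))).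
by rewrite mulrCA powR_mulVN// mulr1.
Qed.

Lemma tail_dist_set_le tau e F (G : distr_fun R) (A : set (distr_fun R)) :
  A G -> (tail_dist tau F G <= e%:E)%E -> (tail_dist_set tau F A <= e%:E)%E.
Proof. by move=> AG; apply: le_trans; apply: ereal_inf_lbound; exists G. Qed.

Lemma pareto_max tau C x : 0 < tau -> 0 < C -> 0 < x ->
  pareto tau C x = Num.max 0 (1 - C * x `^ (- tau)).
Proof.
move=> tau0 C0 x0; rewrite /pareto.
have -> : (C `^ tau^-1 <= x) = (0 <= 1 - C * x `^ (- tau)).
  rewrite /powR !gt_eqF// -{1}[x]lnK ?posrE// ler_expR.
  rewrite mulrC ler_pdivrMr// subr_ge0 -{2}[C]lnK ?posrE// -expRD -expR0 ler_expR.
  by rewrite mulNr subr_le0 mulrC.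
by case: leP.
Qed.

Lemma pareto_distr_fun tau C : 0 < tau -> 0 < C ->
  exists G, forall x, G x = pareto tau C x.
Proof.
move=> tau0 C0; have X0 : 0 < C `^ tau^-1 by exact: powR_gt0.
have p_neg x : x <= 0 -> pareto tau C x = 0.
  by move=> x0; rewrite /pareto leNgt (le_lt_trans x0 X0).
have p_ge0 x : 0 <= pareto tau C x.
  have [x0|/p_neg->//] := ltP 0 x.
  by rewrite pareto_max// le_max lexx.
have nd : {homo pareto tau C : x y / x <= y}.
  move=> x y xy; have [x0|/p_neg->//] := ltP 0 x.
  have y0 : 0 < y by exact: lt_le_trans xy.
  rewrite !pareto_max//.
  have := ler_wpM2l (ltW C0) (ler_powRN (ltW tau0) x0 xy).
  by rewrite ge_max !le_max lexx/= => h; rewrite lerD2l lerN2 h orbT.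
apply: (@distr_fun_of (pareto tau C)) => [|x e e0|x /ltW/p_neg//|x|e e0].
- exact: nd.
- have [xX|Xx] := ltP x (C `^ tau^-1).
    exists ((x + C `^ tau^-1) / 2); first by lra.
    have h : (x + C `^ tau^-1) / 2 < C `^ tau^-1 by lra.
    by rewrite {1}/pareto [_ <= _ / 2]leNgt h addr_ge0// ltW.
  have x0 : 0 < x by exact: lt_le_trans Xx.
  have [y xy hy] := powRN_right (ltW tau0) (ltW C0) x0 e0.
  have y0 : 0 < y by exact: lt_trans xy.
  exists y => //; rewrite !pareto_max//.
  rewrite ge_max; apply/andP; split; first by apply: addr_ge0; [rewrite le_max lexx|exact: ltW].
  rewrite -lerBlDr le_max; apply/orP; right; lra.
- have [x0|/p_neg->//] := ltP 0 x.
  rewrite pareto_max// ge_max ler01/= gerBl mulr_ge0 ?powR_ge0 ?ltW//.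
- have [X hX] := powRN_small tau0 (ltW C0) e0.
  have [x0 hx] := hX X (lexx _); exists X.
  by rewrite pareto_max// le_max; apply/orP; right; lra.
Qed.

Lemma tail_dist_pareto tau C (C' : R) e F : 0 < tau -> 0 < C -> 0 <= e ->
    nneg_supported F ->
    (forall x, 0 < x -> 0 < F x < 1 ->
      `|F x - Num.max 0 (1 - C * x `^ (- tau))| <= e * x `^ (- tau)) ->
  (tail_dist_set tau F (second_order_pareto tau +oo C C') <= e%:E)%E.
Proof.
move=> tau0 C0 e0 Fneg FG; have [G hG] := pareto_distr_fun tau0 C0.
apply: (@tail_dist_set_le _ _ _ G).
  split=> // x x0; rewrite hG /pareto leNgt (lt_trans x0)//.
  exact: powR_gt0.
apply: tail_dist_le => // x x0 Fx.
by rewrite hG pareto_max//; exact: FG.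
Qed.

(* The approximant is [max(F - v, 1 - w)] with [v = e x^-tau] and
   [w = C x^-tau + C' x^(-tau(b+1))], cut to 0 where [F < k]: a maximum of
   nondecreasing functions, although the upper band [1 - C x^-tau + C' ...] is not
   monotone near 0. *)
Lemma tail_dist_second_order tau b C C' (e k : R) F :
    0 < tau -> 0 < b -> 0 < C -> 0 < C' -> 0 < e -> 0 < k < 1 -> nneg_supported F ->
    (forall x, 0 < x -> k <= F x ->
      `|1 - F x - C * x `^ (- tau)| <=
        C' * x `^ (- (tau * (b + 1))) + e * x `^ (- tau)) ->
    (forall x, 0 < x -> 0 < F x < k -> F x <= e * x `^ (- tau)) ->
  (tail_dist_set tau F (second_order_pareto tau b%:E C C') <= e%:E)%E.
Proof.
move=> tau0 b0 C0 C'0 e0 /andP[k0 k1] Fneg Fbig Fsmall.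
have tb0 : 0 < tau * (b + 1) by rewrite mulr_gt0// addr_gt0.
pose v x := e * x `^ (- tau).
pose w1 x := C * x `^ (- tau).
pose w2 x := C' * x `^ (- (tau * (b + 1))).
have v_ge0 x : 0 <= v x by rewrite mulr_ge0 ?powR_ge0 ?ltW.
have w1_ge0 x : 0 <= w1 x by rewrite mulr_ge0 ?powR_ge0 ?ltW.
have w2_ge0 x : 0 <= w2 x by rewrite mulr_ge0 ?powR_ge0 ?ltW.
pose g x := Num.max 0 (Num.max (F x - v x) (1 - (w1 x + w2 x))).
(* The point where [e x^-tau = 1]: before it, replacing [F] by 0 costs at most 1, which is within
   the tolerance, and the support is kept away from 0. *)
pose X0 := expR (ln e / tau).
have X00 : 0 < X0 by exact: expR_gt0.
have X0v x : 0 < x -> x < X0 -> 1 <= v x.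
  move=> x0 xX; rewrite /v expR_powRN// -[e]lnK ?posrE// -expRD -expR0 ler_expR.
  have : ln x < ln e / tau by rewrite -ltr_expR lnK.
  by rewrite ltr_pdivlMr// mulrC; lra.
pose P x := (X0 <= x) && (k <= F x).
pose f x := if P x then g x else 0.
have P0 x : P x -> 0 < x by move=> /andP[/(lt_le_trans X00)].
have Ple x y : x <= y -> P x -> P y.
  move=> xy /andP[Xx kx]; rewrite /P (le_trans Xx)//=.
  exact: le_trans kx (distr_fun_le F xy).
have v_le x y : 0 < x -> x <= y -> v y <= v x.
  by move=> x0 xy; apply: ler_wpM2l; [exact: ltW|apply: ler_powRN => //; exact: ltW].
have w1_le x y : 0 < x -> x <= y -> w1 y <= w1 x.
  by move=> x0 xy; apply: ler_wpM2l; [exact: ltW|apply: ler_powRN => //; exact: ltW].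
have w2_le x y : 0 < x -> x <= y -> w2 y <= w2 x.
  by move=> x0 xy; apply: ler_wpM2l; [exact: ltW|apply: ler_powRN => //; exact: ltW].
have g_ge0 x : 0 <= g x by rewrite /g le_max lexx.
have gE x r : (g x <= r) = [&& 0 <= r, F x - v x <= r & 1 - (w1 x + w2 x) <= r].
  by rewrite /g !ge_max.
have g1 x : F x - v x <= g x by rewrite /g !le_max lexx orbT.
have g2 x : 1 - (w1 x + w2 x) <= g x by rewrite /g !le_max lexx !orbT.
have [G hG] : exists G : distr_fun R, forall x, G x = f x.
  apply: (@distr_fun_of f) => [x y xy|x d d0|x x0|x|d d0].
  - rewrite /f; case: (boolP (P x)) => [Px|_]; last by case: ifP.
    rewrite (Ple _ _ xy Px) gE g_ge0.
    have := v_le _ _ (P0 _ Px) xy; have := w1_le _ _ (P0 _ Px) xy.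
    have := w2_le _ _ (P0 _ Px) xy; have := distr_fun_le F xy.
    by have := g1 y; have := g2 y; move=> *; apply/andP; split; lra.
  - case: (boolP (P x)) => [Px|].
      have x0 := P0 _ Px; have d2 : 0 < d / 2 by lra.
      have [y1 xy1 h1] := distr_fun_right F x d2.
      have [y2 xy2 h2] := powRN_right (ltW tau0) (ltW e0) x0 d2.
      have [y3 xy3 h3] := powRN_right (ltW tau0) (ltW C0) x0 d2.
      have [y4 xy4 h4] := powRN_right (ltW tb0) (ltW C'0) x0 d2.
      pose y := Num.min (Num.min y1 y2) (Num.min y3 y4).
      have xy : x < y by rewrite !lt_min xy1 xy2 xy3 xy4.
      exists y => //; rewrite /f (Ple _ _ (ltW xy) Px) Px gE.
      have y0 : 0 < y by exact: lt_trans xy.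
      have : F y <= F y1 by apply: distr_fun_le; rewrite !ge_min lexx.
      have : v y2 <= v y by apply: v_le => //; rewrite !ge_min lexx !orbT.
      have : w1 y3 <= w1 y by apply: w1_le => //; rewrite !ge_min lexx !orbT.
      have : w2 y4 <= w2 y by apply: w2_le => //; rewrite !ge_min lexx !orbT.
      have := g1 x; have := g2 x; have := g_ge0 x; rewrite /v /w1 /w2 in h2 h3 h4 *.
      by move=> *; apply/and3P; split; lra.
    rewrite negb_and -!ltNge => /orP[xX|Fk].
      exists ((x + X0) / 2); first by lra.
      have h : (x + X0) / 2 < X0 by lra.
      rewrite /f /P [_ <= _ / 2]leNgt h/=.
      by case: ifP => _; apply: addr_ge0 => //; exact: ltW.
    have [|y xy hy] := distr_fun_right F x (e := (k - F x) / 2); first by lra.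
    have h : F y < k by lra.
    exists y => //; rewrite /f /P [k <= F y]leNgt h andbF.
    by case: ifP => _; apply: addr_ge0 => //; exact: ltW.
  - by rewrite /f /P leNgt (lt_trans x0).
  - rewrite /f; case: ifP => // Px; rewrite gE ler01/=.
    by have := v_ge0 x; have := w1_ge0 x; have := w2_ge0 x; have := distr_fun_le1 F x; move=> *; apply/andP; split; lra.
  - have d2 : 0 < d / 2 by lra.
    have [X1 h1] := powRN_small tau0 (ltW C0) d2.
    have [X2 h2] := powRN_small tb0 (ltW C'0) d2.
    have [X3 h3] := distr_fun_near1 F k1.
    pose x := Num.max (Num.max X0 X1) (Num.max X2 X3).
    exists x; rewrite /f /P h3 ?le_max ?lexx ?orbT//=.
    have := h1 x; have := h2 x; rewrite !le_max !lexx ?orbT.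
    by move=> /(_ isT)[_ +] /(_ isT)[_ +]; have := g2 x; rewrite /w1 /w2; lra.
apply: (@tail_dist_set_le _ _ _ G).
  split=> [x x0|x x0]; first by rewrite hG /f /P leNgt (lt_trans x0).
  rewrite hG /f; case: (boolP (P x)); last by rewrite ltxx.
  (* Passing from [F] to [F - v] repairs the lower bound on the tail, and the maximum with
     [1 - (w1 + w2)] the upper one. *)
  move=> /andP[Xx kx] /andP[gx0 _]; have := Fbig x x0 kx; rewrite -/(v x) -/(w1 x) -/(w2 x).
  have gxE : g x = Num.max (F x - v x) (1 - (w1 x + w2 x)).
    by move: gx0; rewrite /g; case: (leP 0 (Num.max _ _)); rewrite ?ltxx.
  have := g1 x; have := g2 x; have := w1_ge0 x; have := w2_ge0 x.
  rewrite !ler_norml.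
  have : g x <= Num.max (F x - v x) (1 - (w1 x + w2 x)) by rewrite gxE.
  by rewrite le_max => /orP[]; lra.
apply: tail_dist_le => //; first exact: ltW.
move=> x x0 /andP[Fx0 Fx1]; rewrite hG /f -/(v x) /P.
have [Xx|Xx]/= := leP X0 x; last first.
  by rewrite subr0 ger0_norm ?(ltW Fx0)//; have := X0v x x0 Xx; lra.
have [kx|kx]/= := leP k (F x); last first.
  by rewrite subr0 ger0_norm ?(ltW Fx0)// Fsmall// Fx0.
have := Fbig x x0 kx; rewrite -/(v x) -/(w1 x) -/(w2 x) !ler_norml => h.
have : g x <= F x + v x.
  by rewrite gE; have := v_ge0 x; move=> *; apply/and3P; split; lra.
by have := g1 x; lra.
Qed.

End distribution_functions.

(** * Comparison of two close tails *)

Section tail_parameters.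
Context {R : realType}.
Implicit Types (F : distr_fun R) (tau b C y k s l u : R).

Lemma expR_sub1 (x : R) : `|x| <= 2^-1 -> `|expR x - 1| <= 2 * `|x|.
Proof.
move=> x2; have h1 := expR_le1DxDxx x2; have h2 := expR_ge1Dx x.
have hx := ler_norm x; have hNx := ler_norm (- x); rewrite normrN in hNx.
have x0 := normr_ge0 x.
have : x ^+ 2 = `|x| ^+ 2 by rewrite real_normK// num_real.
move=> e; rewrite e in h1; rewrite ler_norml.
by move: (`|x|) x0 x2 hx hNx h1 => z *; apply/andP; split; nra.
Qed.

Lemma expR_sub1_inv (x e : R) : `|expR x - 1| <= e -> e <= 2^-1 -> `|x| <= 2 * e.
Proof.
rewrite ler_norml => /andP[h1 h2] e2.
have h3 := expR_ge1Dx x; have h4 := expR_ge1Dx (- x).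
rewrite expRN in h4.
have x0 := expR_gt0 x.
have h5 : (1 - x) * expR x <= 1 by rewrite -ler_pdivlMr// mul1r.
rewrite ler_norml; apply/andP; split; last by lra.
rewrite leNgt; apply/negP => xe; nra.
Qed.

Lemma tail_ratio C0 C1 tau0 tau1 y y' : 0 < C0 -> 0 < C1 ->
  C0 * expR (- (tau0 * y')) =
  C1 * expR (- (tau1 * y)) * expR (ln C0 - ln C1 - tau0 * y' + tau1 * y).
Proof.
move=> C00 C10; rewrite -{1}[C0]lnK ?posrE// -{1}[C1]lnK ?posrE// -!expRD.
by congr expR; ring.
Qed.

(** The logarithm of the ratio of the main terms is affine in the position. Bounds [2 * e] at two
    points at distance 1 bound its slope by [4 * e], and going back to position 0 costs a factor
    [|y|]. *)
Lemma two_point C0 C1 tau0 tau1 y (e : R) : 0 < C0 -> 0 < C1 -> e <= 2^-1 ->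
    (forall i, i = 0 \/ i = 1 ->
      `|C0 * expR (- (tau0 * (y - i))) - C1 * expR (- (tau1 * (y - i)))| <=
        e * (C1 * expR (- (tau1 * (y - i))))) ->
  `|tau0 - tau1| <= 4 * e /\ `|ln C0 - ln C1| <= 2 * e + 4 * e * `|y|.
Proof.
move=> C00 C10 e2 h.
have s_le i : i = 0 \/ i = 1 ->
    `|ln C0 - ln C1 - (tau0 - tau1) * (y - i)| <= 2 * e.
  move=> /h; rewrite (@tail_ratio C0 C1 tau0 tau1 (y - i))//.
  set u := C1 * expR _; have u0 : 0 < u by rewrite mulr_gt0 ?expR_gt0.
  rewrite -{2}[u]mulr1 -mulrBr normrM gtr0_norm// mulrC ler_pM2r// => hs.
  have := expR_sub1_inv hs e2.
  by congr (`| _ | <= _); ring.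
have h0 := s_le 0 (or_introl erefl); have h1 := s_le 1 (or_intror erefl).
have t01 : `|tau0 - tau1| <= 4 * e.
  move: h0 h1; rewrite !ler_norml; lra.
split=> //.
have -> : ln C0 - ln C1 =
    (ln C0 - ln C1 - (tau0 - tau1) * (y - 0)) + (tau0 - tau1) * y by ring.
apply: le_trans (ler_normD _ _) _; apply: lerD => //.
by rewrite normrM ler_wpM2r.
Qed.

(** For a tail mass of order [u], the condition [l <= s^2 u] turns the radius into a relative error
    [s]: both [sqrt (p l)] and [l] are [O(s u)]. *)
Lemma near_tail_rel F0 F1 l s u c x0 x1 : near_tail F0 F1 l x0 x1 ->
    0 <= c -> 0 <= u -> 1 - F1 x1 <= c * u -> 0 <= l <= s ^+ 2 * u -> 0 <= s <= 1 ->
  `|F1 x1 - F0 x0| <= 161%:R * (c + 2) * s * u.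
Proof.
rewrite /near_tail => h c0 u0 pu /andP[l0 lsu] /andP[s0 s1].
have p0 : 0 <= 1 - F1 x1 by rewrite subr_ge0 distr_fun_le1.
move: (1 - F1 x1) pu p0 h => p pu p0 h.
have su : 0 <= s * u by exact: mulr_ge0.
have : Num.sqrt (p * l) <= (c + 1) * (s * u).
  have w0 : 0 <= (c + 1) * (s * u) by rewrite mulr_ge0// addr_ge0.
  rewrite -[leRHS](ger0_norm w0) -sqrtr_sqr ler_wsqrtr//.
  apply: (@le_trans _ _ (c * u * (s ^+ 2 * u))); first exact: ler_pM.
  have -> : c * u * (s ^+ 2 * u) = c * (s * u) ^+ 2 by ring.
  by rewrite [leRHS]exprMn ler_wpM2r ?sqr_ge0//; nra.
have : s ^+ 2 * u <= s * u by rewrite ler_wpM2r//; nra.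
move=> h1 h2; apply: le_trans h _.
have -> : 161%:R * (c + 2) * s * u = 161%:R * ((c + 1) * (s * u) + s * u) by ring.
by rewrite ler_wpM2l// lerD//; apply: le_trans lsu h1.
Qed.

(** The finite-[beta] condition in the variable [log x]. Exact Pareto laws meet it too, so both
    kinds of null class share the estimates below. *)
Definition tail_band tau b C (C' : R) F : Prop := forall y, 0 < F (expR y) ->
  `|1 - F (expR y) - C * expR (- (tau * y))| <=
    C' * (expR (- (tau * y)) * expR (- (tau * b * y))).

Lemma expRN_le (a x y : R) : 0 <= a -> x <= y -> expR (- (a * y)) <= expR (- (a * x)).
Proof. by move=> a0 xy; rewrite ler_expR lerN2 ler_wpM2l. Qed.

Lemma tail_band_le tau b C (C' : R) F y : 0 <= C' -> 0 <= tau -> 0 <= b -> 0 <= y ->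
  tail_band tau b C C' F -> 0 < F (expR y) ->
  1 - F (expR y) <= (C + C') * expR (- (tau * y)).
Proof.
move=> C'0 tau0 b0 y0 hF /hF; rewrite ler_norml => /andP[_ h].
have u0 := expR_ge0 (- (tau * y)).
have v1 : expR (- (tau * b * y)) <= 1.
  by rewrite -expR0 ler_expR oppr_le0 !mulr_ge0.
have v0 := expR_ge0 (- (tau * b * y)).
have : C' * (expR (- (tau * y)) * expR (- (tau * b * y))) <= C' * expR (- (tau * y)).
  by rewrite ler_wpM2l// ler_piMr.
lra.
Qed.

Definition cmp_const (ch C' : R) : R := 161%:R * (ch + C' + 2).

(** Bounds the ratio of [expR (- (tau0 * y))] to [expR (- (tau1 * y))] once the second-order term of
    [F0] is at most half its main term. *)
Definition tail_cst (cl ch C' : R) : R := 2 * (ch + C' + cmp_const ch C') / cl.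

(** Summands: sampling deviation, second-order term of [F0], second-order term of [F1]. *)
Definition param_cst (cl ch C' b1 : R) : R :=
  cmp_const ch C' +
  C' * tail_cst cl ch C' * expR (b1 * ln (tail_cst cl ch C')) + C'.

Lemma cmp_const_ge0 ch (C' : R) : 0 <= ch -> 0 <= C' -> 0 <= cmp_const ch C'.
Proof. by move=> ? ?; rewrite /cmp_const mulr_ge0// !addr_ge0. Qed.

Lemma tail_cst_gt0 cl ch (C' : R) : 0 < cl -> 0 < ch -> 0 < C' -> 0 < tail_cst cl ch C'.
Proof.
move=> cl0 ch0 C'0; rewrite divr_gt0// mulr_gt0// addr_gt0 ?addr_gt0//.
by rewrite /cmp_const mulr_gt0// !addr_gt0.
Qed.

Lemma param_cst_ge0 cl ch (C' b1 : R) : 0 < cl -> 0 < ch -> 0 < C' ->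
  0 <= param_cst cl ch C' b1.
Proof.
move=> cl0 ch0 C'0.
rewrite /param_cst !addr_ge0 ?(ltW C'0) ?cmp_const_ge0 ?(ltW C'0) ?(ltW ch0)//.
by rewrite mulr_ge0 ?expR_ge0// mulr_ge0 ?(ltW C'0)// ltW// tail_cst_gt0.
Qed.

(** Triangle inequality along [C0 u'], [1 - F0], [1 - F1], [C1 u]. The first smallness assumption
    keeps [F0] positive, so that its band applies; the second lets this band bound [u'] by a
    multiple of [u]. As [b1 <= b], the bias of [F0] is at most of the order of that of [F1]. *)
Lemma param_rel F0 F1 tau0 tau1 C0 C1 cl ch (C' b1 tl : R) b y s l :
    0 < cl -> 0 < ch -> 0 < C' -> 0 < b1 -> b1 <= b -> 0 < tl -> 0 < tau1 ->
    tl <= tau0 -> cl <= C0 -> C1 <= ch ->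
    tail_band tau0 b C0 C' F0 -> tail_band tau1 b1 C1 C' F1 -> 0 <= y ->
    0 < F1 (expR y) -> near_tail F0 F1 l (expR y) (expR y) ->
    0 <= l <= s ^+ 2 * expR (- (tau1 * y)) -> 0 <= s <= 1 ->
    (ch + C' + cmp_const ch C') * expR (- (tau1 * y)) <= 2^-1 ->
    C' * expR (- (tl * b * y)) <= cl / 2 ->
  `|C0 * expR (- (tau0 * y)) - C1 * expR (- (tau1 * y))| <=
    param_cst cl ch C' b1 * (s + expR (- (tau1 * b1 * y))) * expR (- (tau1 * y)).
Proof.
move=> cl0 ch0 C'0 b10 b1b tl0 tau10 tlt clC C1ch F0band F1band y0 F1y near ls s01 small1 small2.
have c4p := tail_cst_gt0 cl0 ch0 C'0.
have c2p := cmp_const_ge0 (ltW ch0) (ltW C'0).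
have b0 : 0 < b by exact: lt_le_trans b1b.
have tau00 : 0 < tau0 by exact: lt_le_trans tlt.
set u := expR (- (tau1 * y)) in ls small1 *.
have u0 : 0 < u by exact: expR_gt0.
have pu : 1 - F1 (expR y) <= (ch + C') * u.
  apply: le_trans (tail_band_le (ltW C'0) (ltW tau10) (ltW b10) y0 F1band F1y) _.
  by rewrite ler_pM2r// lerD2r.
have near' : `|F1 (expR y) - F0 (expR y)| <= cmp_const ch C' * s * u.
  apply: near_tail_rel near _ (ltW u0) pu ls s01.
  by rewrite addr_ge0// ltW.
have /andP[s0 s1] := s01.
have su : cmp_const ch C' * s * u <= cmp_const ch C' * u.
  by rewrite ler_pM2r// ler_piMr.
have F0y : 0 < F0 (expR y).
  by move: near'; rewrite ler_norml; lra.
set u' := expR (- (tau0 * y)).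
have u'0 : 0 < u' by exact: expR_gt0.
have p0u : 1 - F0 (expR y) <= (ch + C' + cmp_const ch C') * u.
  by move: near'; rewrite ler_norml; lra.
have h0 := F0band y F0y; rewrite -/u' in h0.
have v_small : C' * expR (- (tau0 * b * y)) <= cl / 2.
  apply: le_trans small2; rewrite ler_pM2l// ler_expR lerN2.
  by rewrite ler_wpM2r// ler_pM2r.
have u'u : u' <= tail_cst cl ch C' * u.
  rewrite /tail_cst mulrAC ler_pdivlMr//.
  have : C' * (u' * expR (- (tau0 * b * y))) <= cl / 2 * u'.
    by rewrite mulrCA mulrC ler_pM2r.
  have : cl * u' <= C0 * u' by rewrite ler_pM2r.
  by move: h0; rewrite ler_norml; lra.
have vv : expR (- (tau0 * b * y)) <=
    expR (b1 * ln (tail_cst cl ch C')) * expR (- (tau1 * b1 * y)).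
  have : - (tau0 * y) <= ln (tail_cst cl ch C') - tau1 * y.
    by rewrite -ler_expR expRD lnK ?posrE.
  move=> /(ler_wpM2l (ltW b10)) h.
  have : tau0 * y * b1 <= tau0 * y * b by rewrite ler_wpM2l// mulr_ge0// ltW.
  by rewrite -expRD ler_expR; lra.
have h1 := F1band y F1y; rewrite -/u in h1.
have hb : C' * (u' * expR (- (tau0 * b * y))) <=
    C' * tail_cst cl ch C' * expR (b1 * ln (tail_cst cl ch C')) * expR (- (tau1 * b1 * y)) * u.
  have h := ler_pM (ltW u'0) (expR_ge0 _) u'u vv.
  apply: le_trans (ler_wpM2l (ltW C'0) h) _.
  by rewrite le_eqVlt; apply/orP; left; apply/eqP; ring.
rewrite /param_cst; move: near' h0 h1 hb; rewrite !ler_norml.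
set v := expR (- (tau1 * b1 * y)); set w := expR (- (tau0 * b * y)).
have v0 : 0 < v by exact: expR_gt0.
set c2 := cmp_const _ _; set c5 := C' * tail_cst _ _ _ * _.
have c50 : 0 <= c5.
  by rewrite /c5 mulr_ge0 ?expR_ge0// mulr_ge0 ?(ltW C'0) ?(ltW c4p).
have u0' := ltW u0; have v0' := ltW v0; have C'0' := ltW C'0.
have : 0 <= c2 * v * u by apply: mulr_ge0 => //; exact: mulr_ge0.
have : 0 <= c5 * s * u by apply: mulr_ge0 => //; exact: mulr_ge0.
have : 0 <= C' * s * u by apply: mulr_ge0 => //; exact: mulr_ge0.
have -> : (c2 + c5 + C') * (s + v) * u = c2 * s * u + c2 * v * u + c5 * s * u
  + c5 * v * u + C' * s * u + C' * (u * v) by ring.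
lra.
Qed.

End tail_parameters.

(** The first alternative serves the far tail, where the second-order term of [F1] is within the
    error and [F0] is not consulted; [C1 * u <= 1] says that the Pareto law of [F1] is not cut to 0
    there. The second compares main and second-order terms separately, since the band of the null
    class involves both. *)
Definition tails_compared {R : realType} (b C' : R) (F0 F1 : distr_fun R)
    (tau0 tau1 C0 C1 d y : R) : Prop :=
  let u := expR (- (tau1 * y)) in
  (`|1 - F1 (expR y) - C1 * u| <= d * u /\ C1 * u <= 1) \/
  exists y', [/\ `|F1 (expR y) - F0 (expR y')| <= d * u,
    `|C0 * expR (- (tau0 * y')) - C1 * u| <= d * u &
    `|C' * (expR (- (tau0 * y')) * expR (- (tau0 * b * y'))) -
      C' * (u * expR (- (tau1 * b * y)))| <= d * u].

(** * Deterministic comparison of two coupled distributions *)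

Section deterministic_comparison.
Context {R : realType} (tl th cl ch C' b1 b : R).
Hypotheses (tl0 : 0 < tl) (cl0 : 0 < cl) (C'0 : 0 < C') (b10 : 0 < b1) (b1b : b1 <= b).
Implicit Types (F : distr_fun R) (tau C y s l u K : R).

(** Relative noise plus relative bias at tail mass about [e^-K]; the factor [expR (2 * b1 * th)]
    admits points up to 2 to the left of [K / tau1]. *)
Definition param_err K s : R :=
  param_cst cl ch C' b1 / cl * (s + expR (2 * b1 * th) * expR (- (b1 * K))).

Section two_tails.
Variables (n : nat) (L M K : R) (F0 F1 : distr_fun R) (tau0 tau1 C0 C1 s1 s2 : R).
Hypothesis cpl : coupled n L M K F0 F1 tau0 tau1.
Hypotheses (F0band : tail_band tau0 b C0 C' F0) (F1band : tail_band tau1 b1 C1 C' F1).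
Hypotheses (tau0I : tl <= tau0 <= th) (tau1I : tl <= tau1 <= th).
Hypotheses (C0I : cl <= C0 <= ch) (C1I : cl <= C1 <= ch).
Hypotheses (Ls : 0 <= L / n%:R <= s1 ^+ 2 * expR (- K)).
Hypotheses (Ms : 0 <= M / n%:R <= s2 ^+ 2 * expR (- K)).
Hypotheses (s1I : 0 <= s1 <= 1) (s2I : 0 <= s2 <= 1).
Hypothesis Kth : 2 <= K / th.
Hypothesis Kn : K / tl < n%:R.

Let tau00 : 0 < tau0. Proof. by move: tau0I => /andP[h _]; exact: lt_le_trans h. Qed.
Let tau10 : 0 < tau1. Proof. by move: tau1I => /andP[h _]; exact: lt_le_trans h. Qed.
Let th0 : 0 < th.
Proof. by move: tau0I => /andP[h1 h2]; apply: lt_le_trans (le_trans h1 h2). Qed.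
Let C00 : 0 < C0. Proof. by move: C0I => /andP[h _]; exact: lt_le_trans h. Qed.
Let C10 : 0 < C1. Proof. by move: C1I => /andP[h _]; exact: lt_le_trans h. Qed.
Let ch0 : 0 < ch.
Proof. by move: C0I => /andP[h1 h2]; apply: lt_le_trans (le_trans h1 h2). Qed.
Let K0 : 0 < K.
Proof. by move: Kth; rewrite ler_pdivlMr//; have := th0; lra. Qed.
Let Ktau1 : K / th <= K / tau1 <= K / tl.
Proof.
by move: tau1I => /andP[h1 h2]; rewrite !ler_pM2l// !lef_pV2 ?posrE ?h1 ?h2.
Qed.

Lemma large_tail y : K / tau1 - 2 <= y ->
  expR (- (tau1 * y)) <= expR (2 * th) * expR (- K) /\
  expR (- (tau1 * b1 * y)) <= expR (2 * b1 * th) * expR (- (b1 * K)).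
Proof.
move=> Ky; rewrite -!expRD !ler_expR.
have h : K - 2 * th <= tau1 * y.
  have /andP[_ t1] := tau1I.
  have := ler_wpM2l (ltW tau10) Ky; rewrite mulrBr mulrC divfK ?gt_eqF//; lra.
by split; [lra|have := ler_wpM2l (ltW b10) h; lra].
Qed.

Hypothesis smallK : (ch + C' + cmp_const ch C') * (expR (2 * th) * expR (- K)) <= 2^-1.
Hypothesis bandK : C' * expR (- (tl * b * (K / th - 2))) <= cl / 2.
Hypotheses (err1 : param_err K s1 <= 2^-1) (err2 : param_err K s2 <= 2^-1).
Hypothesis err1K : K * (4 * param_err K s1) <= tl ^+ 2.

Lemma param_point (j : nat) s l : K / tau1 - 2 <= j%:R <= K / tau1 ->
    0 < F1 (expR j%:R) -> near_tail F0 F1 l (expR j%:R) (expR j%:R) ->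
    0 <= l <= s ^+ 2 * expR (- K) -> 0 <= s <= 1 ->
  `|C0 * expR (- (tau0 * j%:R)) - C1 * expR (- (tau1 * j%:R))| <=
     param_err K s * (C1 * expR (- (tau1 * j%:R))).
Proof.
move=> /andP[j1 j2] F1j near /andP[l0 ls] sI.
have [u_le v_le] := large_tail j1.
have /andP[c0 c0'] := C0I; have /andP[c1 c1'] := C1I; have /andP[t0 t0'] := tau0I.
have uK : expR (- K) <= expR (- (tau1 * j%:R)).
  by rewrite ler_expR lerN2 mulrC -ler_pdivlMr.
have b0 : 0 < b by exact: lt_le_trans b1b.
have := param_rel (l := l) (s := s) cl0 ch0 C'0 b10 b1b tl0 tau10 t0 c0 c1' F0band F1band
  (ler0n _ j) F1j near.
have pc0 := param_cst_ge0 b1 cl0 ch0 C'0.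
move=> h; apply: le_trans (h _ _ _ _) _ => //.
- by rewrite l0/=; apply: le_trans ls _; rewrite ler_wpM2l ?sqr_ge0.
- apply: le_trans smallK; rewrite ler_wpM2l// addr_ge0 ?cmp_const_ge0 ?(ltW C'0) ?(ltW ch0)//.
  by rewrite addr_ge0 ?(ltW C'0) ?(ltW ch0).
- apply: le_trans bandK; rewrite ler_wpM2l ?(ltW C'0)// expRN_le//.
    by rewrite mulr_ge0 ?(ltW tl0) ?(ltW b0).
  by have /andP[? _] := Ktau1; lra.
- rewrite /param_err; move: v_le pc0.
  have w0 : 0 <= expR (2 * b1 * th) * expR (- (b1 * K)) by rewrite mulr_ge0 ?expR_ge0.
  move: (param_cst _ _ _ _) (expR (- (tau1 * b1 * _))) (_ * expR (- (b1 * K))) w0.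
  move=> pc v w w0 vw pc0; rewrite mulrA ler_pM2r ?expR_gt0//.
  have /andP[s0 _] := sI.
  apply: (@le_trans _ _ (pc * (s + w))); first by rewrite ler_wpM2l// lerD2l.
  have -> : pc / cl * (s + w) * C1 = pc * (s + w) * (C1 / cl) by ring.
  by rewrite ler_peMr ?mulr_ge0 ?addr_ge0// ler_pdivlMr// mul1r.
Qed.

(* With j = floor (K / tau1): if F1 vanishes at e^(j-1), its support lies where the
   second-order term is negligible.  Otherwise both tails are evaluated at e^j and
   e^(j-1), first with the crude error s1, which shows that these points also
   belong to the window of tau0, and then with the sharp error s2. *)
Lemma param_close :
  (forall y, 0 < F1 (expR y) -> K / tau1 - 2 <= y) \/
  (`|tau0 - tau1| <= 4 * param_err K s2 /\
   `|ln C0 - ln C1| <= 2 * param_err K s2 + 4 * param_err K s2 * (K / tl)).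
Proof.
have [_ cpl_grid cpl_spec] := cpl.
have /andP[t0 t0'] := tau0I; have /andP[t1 t1'] := tau1I.
have /andP[Kt1 Kt1'] := Ktau1.
have Kt0 : 0 <= K / tau1 by rewrite divr_ge0 ?ltW.
pose j := Num.truncn (K / tau1).
have := truncn_itv Kt0; rewrite -/j => /andP[j1 j2'].
have j2 : K / tau1 < j%:R + 1 by rewrite natr1.
have Kth2 := Kth; have Kn' := Kn.
have j_gt0 : (0 < j)%N by rewrite -(ltr_nat R); lra.
have jn : (j <= n)%N by rewrite -(ler_nat R); lra.
have [F1j|F1j] := ltP 0 (F1 (expR (j.-1)%:R)); last first.
  left=> y Fy; rewrite leNgt; apply/negP => yj; move: Fy; apply/negP; rewrite -leNgt.
  apply: le_trans F1j; apply: distr_fun_le; rewrite ler_expR.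
  by rewrite -subn1 natrB//; lra.
right.
have jE i : i = 0 \/ i = 1 -> exists2 m : nat, j%:R - i = m%:R & (m = j) \/ (m = j.-1).
  case=> ->; first by exists j; [rewrite subr0|left].
  by exists j.-1; [rewrite -subn1 natrB|right].
have F1m m : m = j \/ m = j.-1 -> 0 < F1 (expR m%:R).
  case=> ->//; apply: lt_le_trans F1j _; apply: distr_fun_le.
  by rewrite ler_expR ler_nat leq_pred.
have mI m : m = j \/ m = j.-1 -> (m <= n)%N /\ K / tau1 - 2 <= m%:R <= K / tau1.
  case=> ->.
    by split=> //; lra.
  split; first exact: leq_trans (leq_pred _) jn.
  by rewrite -subn1 natrB//; lra.
have [t01 _] : `|tau0 - tau1| <= 4 * param_err K s1 /\
    `|ln C0 - ln C1| <= 2 * param_err K s1 + 4 * param_err K s1 * `|j%:R : R|.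
  apply: two_point => // i /jE[m -> hm]; have [mn mK] := mI m hm.
  exact: param_point mK (F1m m hm) (cpl_grid m mn) Ls s1I.
(* The centres of the windows differ by at most 1, so a point within 2 of [K / tau1] is within 3 of
   [K / tau0]: this is the origin of the radius 3. *)
have Kt01 : `|K / tau0 - K / tau1| <= 1.
  have -> : K / tau0 - K / tau1 = K * (tau1 - tau0) / (tau0 * tau1).
    by field; rewrite !gt_eqF.
  rewrite normrM normfV [X in _ / X]gtr0_norm ?mulr_gt0// ler_pdivrMr ?mulr_gt0// mul1r.
  rewrite normrM gtr0_norm// distrC.
  apply: (@le_trans _ _ (tl ^+ 2)).
    by apply: le_trans err1K; rewrite ler_pM2l.
  by rewrite expr2 ler_pM// ltW.
have [t01' C01'] : `|tau0 - tau1| <= 4 * param_err K s2 /\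
    `|ln C0 - ln C1| <= 2 * param_err K s2 + 4 * param_err K s2 * `|j%:R : R|.
  apply: two_point => // i /jE[m -> hm]; have [mn mK] := mI m hm.
  apply: (param_point mK (F1m m hm) (cpl_spec m mn _ _) Ms s2I).
    by move: Kt01 mK; rewrite !ler_norml; lra.
  by move: mK; rewrite !ler_norml; lra.
split=> //; apply: le_trans C01' _; rewrite lerD2l ler_wpM2l//.
  by have := normr_ge0 (tau0 - tau1); lra.
by rewrite ger0_norm//; lra.
Qed.

(** Bounds [|ln C0 - ln C1 - tau0 y' + tau1 y|], the logarithm of the ratio of main terms. The
    factors [K / tl] carry the logarithm of the rate; [th / n] pays for the shift from [y] to
    [y']. *)
Definition growth_err Y : R :=
  2 * param_err K s2 + 4 * param_err K s2 * (K / tl) +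
  4 * param_err K s2 * (Y + K / tl) + th / n%:R.

(** In order: bias of [F1] in the far tail, deviation between the two distributions, main terms,
    second-order terms. The exponentials in [Y] pay for negative [y], where the second-order factor
    exceeds 1. *)
Definition tail_err Y : R :=
  C' * (expR (2 * b1 * th) * expR (- (b1 * K))) +
  161%:R * (ch + C' * expR (th * b1 * Y) + 2) * s1 +
  2 * ch * growth_err Y +
  C' * (2 * ((b + 1) * growth_err Y)) * expR (th * b * Y).

(** Up to [K / tau1] the power [expR (- (tau1 * y))] is at least [e^-K], so the relative error [s1]
    holds throughout. Both differences of powers are a power times [expR z - 1], with [z] controlled
    by [growth_err]. *)
Lemma middle_close Y y (g := growth_err Y) :
    `|tau0 - tau1| <= 4 * param_err K s2 ->
    `|ln C0 - ln C1| <= 2 * param_err K s2 + 4 * param_err K s2 * (K / tl) ->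
    0 <= Y <= n%:R -> - Y <= y <= K / tau1 -> 0 < F1 (expR y) -> (b + 1) * g <= 2^-1 ->
  exists y', [/\
    `|F1 (expR y) - F0 (expR y')| <=
      161%:R * (ch + C' * expR (th * b1 * Y) + 2) * s1 * expR (- (tau1 * y)),
    `|C0 * expR (- (tau0 * y')) - C1 * expR (- (tau1 * y))| <=
      2 * ch * g * expR (- (tau1 * y)) &
    `|C' * (expR (- (tau0 * y')) * expR (- (tau0 * b * y'))) -
      C' * (expR (- (tau1 * y)) * expR (- (tau1 * b * y)))| <=
      C' * (2 * ((b + 1) * g)) * expR (th * b * Y) * expR (- (tau1 * y))].
Proof.
move=> t01 C01 /andP[Y0 Yn] /andP[yY yK] F1y g2.
have [cpl_all _ _] := cpl.
have /andP[t0 t0'] := tau0I; have /andP[t1 t1'] := tau1I.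
have /andP[c1 c1'] := C1I.
have /andP[Kt1 Kt1'] := Ktau1; have Kn' := Kn.
have b0 : 0 < b by exact: lt_le_trans b1b.
have t0p := tau00; have t1p := tau10; have C0p := C00; have C1p := C10.
have thp := th0; have chp := ch0.
have yI : - n%:R <= y < n%:R by apply/andP; split; lra.
have [y' yy' near] := cpl_all y yI; exists y'.
have u0 : 0 < expR (- (tau1 * y)) by exact: expR_gt0.
have pow_le a : 0 <= a -> expR (- (tau1 * a * y)) <= expR (th * a * Y).
  move=> a0; rewrite ler_expR -mulrN.
  apply: (@le_trans _ _ (tau1 * a * Y)).
    by rewrite ler_wpM2l ?mulr_ge0 ?(ltW t1p)//; lra.
  by rewrite ler_wpM2r// ler_wpM2r.
have yW : `|y| <= Y + K / tl.
  have : 0 <= K / tl by rewrite divr_ge0 ?(ltW K0) ?(ltW tl0).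
  by rewrite ler_norml; move=> ?; apply/andP; split; lra.
have dt : `|(tau0 - tau1) * y| <= 4 * param_err K s2 * (Y + K / tl).
  by rewrite normrM ler_pM.
have dn : `|tau0 * (y' - y)| <= th / n%:R.
  by rewrite normrM gtr0_norm// distrC ler_pM// ltW.
have e1 : `|ln C0 - ln C1 - tau0 * y' + tau1 * y| <= g.
  have -> : ln C0 - ln C1 - tau0 * y' + tau1 * y =
    (ln C0 - ln C1) - (tau0 - tau1) * y - tau0 * (y' - y) by ring.
  apply: le_trans (ler_normB _ _) _; apply: lerD => //.
  by apply: le_trans (ler_normB _ _) _; apply: lerD.
have e2 : `|(b + 1) * (- (tau0 * y') + tau1 * y)| <= (b + 1) * g.
  rewrite normrM gtr0_norm ?ler_pM2l; try lra.
  have -> : - (tau0 * y') + tau1 * y =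
    0 - (tau0 - tau1) * y - tau0 * (y' - y) by ring.
  apply: le_trans (ler_normB _ _) _; apply: lerD => //.
  apply: le_trans (ler_normB _ _) _; apply: lerD => //.
  by rewrite normr0; have := normr_ge0 (ln C0 - ln C1); lra.
have g0 : 0 <= g by apply: le_trans (normr_ge0 _) e1.
split.
- apply: near_tail_rel near _ (ltW u0) _ _ s1I.
  + by rewrite addr_ge0 ?mulr_ge0 ?expR_ge0 ?(ltW chp) ?(ltW C'0).
  + have := F1band F1y; rewrite ler_norml => /andP[_].
    have : C1 * expR (- (tau1 * y)) <= ch * expR (- (tau1 * y)) by rewrite ler_pM2r.
    have : C' * (expR (- (tau1 * y)) * expR (- (tau1 * b1 * y))) <=
           C' * (expR (- (tau1 * y)) * expR (th * b1 * Y)).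
      by rewrite ler_pM2l// ler_pM2l//; apply: pow_le; exact: ltW.
    lra.
  + have /andP[-> Ls'] /= := Ls; apply: le_trans Ls' _.
    by rewrite ler_wpM2l ?sqr_ge0// ler_expR lerN2 mulrC -ler_pdivlMr.
- rewrite (tail_ratio tau0 tau1 y y' C0p C1p).
  rewrite -[X in _ - X]mulr1 -mulrBr normrM gtr0_norm ?mulr_gt0//.
  have h1 : `|ln C0 - ln C1 - tau0 * y' + tau1 * y| <= 2^-1.
    by apply: le_trans e1 _; apply: le_trans g2; rewrite mulrDl mul1r lerDr mulr_ge0 ?(ltW b0).
  have h2 := expR_sub1 h1.
  have h3 : `|expR (ln C0 - ln C1 - tau0 * y' + tau1 * y) - 1| <= 2 * g by lra.
  have -> : 2 * ch * g * expR (- (tau1 * y)) = ch * expR (- (tau1 * y)) * (2 * g) by ring.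
  by rewrite ler_pM ?mulr_ge0 ?(ltW C1p) ?(ltW u0)// ler_pM2r.
- have -> : expR (- (tau0 * y')) * expR (- (tau0 * b * y')) =
    expR (- (tau1 * y)) * expR (- (tau1 * b * y)) *
    expR ((b + 1) * (- (tau0 * y') + tau1 * y)).
    by rewrite -!expRD; congr expR; ring.
  have h2 := expR_sub1 (le_trans e2 g2).
  rewrite -[X in _ - _ * X]mulr1 -mulrBr -mulrBr normrM gtr0_norm// normrM.
  rewrite gtr0_norm ?mulr_gt0 ?expR_gt0//.
  have h3 : `|expR ((b + 1) * (- (tau0 * y') + tau1 * y)) - 1| <= 2 * ((b + 1) * g).
    by apply: le_trans h2 _; rewrite ler_pM2l.
  have -> : C' * (2 * ((b + 1) * g)) * expR (th * b * Y) * expR (- (tau1 * y)) =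
    C' * (expR (- (tau1 * y)) * expR (th * b * Y) * (2 * ((b + 1) * g))) by ring.
  rewrite ler_pM2l// ler_pM ?mulr_ge0 ?expR_ge0// ler_pM2l//.
  exact: pow_le (ltW b0).
Qed.

Hypothesis chK : ch * (expR (2 * th) * expR (- K)) <= 1.

(** If the support of [F1] starts no earlier than [K / tau1 - 2], or if [y] lies beyond [K / tau1],
    the bias of [F1] is already within the error. Closeness of the parameters is called upon only in
    the remaining case. *)
Lemma tail_comparison Y y : 0 <= Y <= n%:R -> (b + 1) * growth_err Y <= 2^-1 ->
    - Y <= y -> 0 < F1 (expR y) ->
  tails_compared b C' F0 F1 tau0 tau1 C0 C1 (tail_err Y) y.
Proof.
move=> YI g2 yY F1y.
have /andP[c1 c1'] := C1I; have /andP[s10 _] := s1I.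
have b0 : 0 < b by exact: lt_le_trans b1b.
have u0 : 0 < expR (- (tau1 * y)) by exact: expR_gt0.
have chp := ch0; have e20 : 0 <= param_err K s2.
  have /andP[s20 _] := s2I; have pc0 := param_cst_ge0 b1 cl0 chp C'0.
  by rewrite /param_err mulr_ge0 ?divr_ge0 ?(ltW cl0)// addr_ge0// mulr_ge0 ?expR_ge0.
have /andP[Y0 Yn] := YI.
have Ktl : 0 <= K / tl by rewrite divr_ge0 ?(ltW K0) ?(ltW tl0).
have g0 : 0 <= growth_err Y.
  have W0 : 0 <= Y + K / tl by exact: addr_ge0.
  have e40 : 0 <= 4 * param_err K s2 by exact: mulr_ge0.
  have thn : 0 <= th / n%:R by rewrite divr_ge0// ltW// th0.
  rewrite /growth_err; apply: addr_ge0 => //; apply: addr_ge0; last exact: mulr_ge0.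
  by apply: addr_ge0; apply: mulr_ge0.
have E1 : 0 <= C' * (expR (2 * b1 * th) * expR (- (b1 * K))).
  by rewrite !mulr_ge0 ?expR_ge0 ?(ltW C'0).
have E2 : 0 <= 161%:R * (ch + C' * expR (th * b1 * Y) + 2) * s1.
  by rewrite mulr_ge0// mulr_ge0// !addr_ge0 ?mulr_ge0 ?expR_ge0 ?(ltW C'0) ?(ltW chp).
have E3 : 0 <= 2 * ch * growth_err Y by rewrite !mulr_ge0 ?(ltW chp).
have E4 : 0 <= C' * (2 * ((b + 1) * growth_err Y)) * expR (th * b * Y).
  have bg : 0 <= (b + 1) * growth_err Y.
    by apply: mulr_ge0 => //; apply: addr_ge0 => //; exact: ltW.
  by rewrite mulr_ge0 ?expR_ge0// mulr_ge0 ?(ltW C'0)// mulr_ge0.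
have far : K / tau1 - 2 <= y ->
    `|1 - F1 (expR y) - C1 * expR (- (tau1 * y))| <= tail_err Y * expR (- (tau1 * y)) /\
    C1 * expR (- (tau1 * y)) <= 1.
  move=> /large_tail[u_le v_le]; split.
    apply: le_trans (F1band F1y) _.
    rewrite mulrCA mulrC; apply: ler_wpM2r; first exact: ltW.
    apply: (@le_trans _ _ (C' * (expR (2 * b1 * th) * expR (- (b1 * K))))).
      by rewrite ler_pM2l.
    by rewrite /tail_err; lra.
  by apply: le_trans chK; rewrite ler_pM ?(ltW C10) ?(ltW u0).
have [/(_ y F1y)/far|[t01 C01]] := param_close; first by left.
have [Ky|yK] := leP (K / tau1) y; first by left; apply: far; lra.
right; have yI : - Y <= y <= K / tau1 by rewrite yY ltW.
have [y' [h1 h2 h3]] := middle_close t01 C01 YI yI F1y g2.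
exists y'; split.
- by apply: le_trans h1 _; rewrite ler_pM2r// /tail_err; lra.
- by apply: le_trans h2 _; rewrite ler_pM2r// /tail_err; lra.
- by apply: le_trans h3 _; rewrite ler_pM2r// /tail_err; lra.
Qed.

End two_tails.
End deterministic_comparison.

(** * Distance from the alternative to the null class with its own parameters *)

Section separation.
Context {R : realType}.
Implicit Types (F : distr_fun R) (tau C b d y : R).

Lemma second_order_band tau b C (C' : R) F :
  second_order_pareto tau b%:E C C' F -> tail_band tau b C C' F.
Proof.
move=> [_ hF] y Fy; have := hF _ (expR_gt0 y).
rewrite Fy distr_fun_le1 => /(_ isT).
rewrite !expR_powRN ?expR_gt0// expRK -expRD.
by congr (_ <= _ * expR _); ring.
Qed.

Lemma pareto_band tau b C (C' : R) F : 0 < tau -> 0 < C -> 0 <= C' ->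
  second_order_pareto tau +oo C C' F -> tail_band tau b C C' F.
Proof.
move=> tau0 C0 C'0 [_ hF] y; rewrite hF pareto_max ?expR_gt0//.
rewrite expR_powRN ?expR_gt0// expRK.
have [h _|h] := leP 0 (1 - C * expR (- (tau * y))); last by rewrite ltxx.
rewrite [X in `|X|](_ : _ = 0) ?normr0 ?mulr_ge0 ?expR_ge0//; ring.
Qed.

(** The positive part is 1-Lipschitz, so closeness of main terms passes to the Pareto laws. Left of
    [- Y] nothing is compared, but the Pareto law of [F1] vanishes, [F1] stays below its value at
    [e^-Y], and the tolerance grows. *)
Lemma pareto_separation tau0 tau1 C0 C1 (C' : R) b d Y F0 F1 :
    0 < tau0 -> 0 < tau1 -> 0 < C0 -> 0 < C1 -> 0 <= d ->
    second_order_pareto tau0 +oo C0 C' F0 -> nneg_supported F1 ->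
    2 <= C1 * expR (tau1 * Y) ->
    (forall y, - Y <= y -> 0 < F1 (expR y) ->
      tails_compared b C' F0 F1 tau0 tau1 C0 C1 d y) ->
  (tail_dist_set tau1 F1 (second_order_pareto tau1 +oo C1 C') <= (2 * d)%:E)%E.
Proof.
move=> tau00 tau10 C00 C10 d0 [_ hF0] F1neg hY comp.
have near y : - Y <= y -> 0 < F1 (expR y) ->
    `|F1 (expR y) - Num.max 0 (1 - C1 * expR (- (tau1 * y)))| <=
      2 * d * expR (- (tau1 * y)).
  move=> yY Fy; have u0 := expR_gt0 (- (tau1 * y)).
  have du : 0 <= d * expR (- (tau1 * y)) by rewrite mulr_ge0// ltW.
  have [[h1 h2]|[y' [h1 h2 _]]] := comp y yY Fy.
    rewrite max_r ?subr_ge0//; move: h1; rewrite !ler_norml; lra.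
  move: h1; rewrite hF0 pareto_max ?expR_gt0// expR_powRN ?expR_gt0// expRK => h1.
  have : `|Num.max 0 (1 - C0 * expR (- (tau0 * y'))) -
      Num.max 0 (1 - C1 * expR (- (tau1 * y)))| <= d * expR (- (tau1 * y)).
    move: h2; rewrite !ler_norml.
    have [?|?] := leP 0 (1 - C0 * expR (- (tau0 * y')));
      have [?|?] := leP 0 (1 - C1 * expR (- (tau1 * y))); lra.
  move: h1; rewrite !ler_norml; lra.
apply: tail_dist_pareto => //; first by rewrite mulr_ge0.
move=> x x0 /andP[Fx _]; rewrite expR_powRN//.
have xE : expR (ln x) = x by rewrite lnK.
rewrite -xE in Fx *; move: (ln x) Fx => y Fy; rewrite expRK.
have [|yY] := leP (- Y) y; first by move=> /near; apply.
have FY : F1 (expR y) <= F1 (expR (- Y)) by apply: distr_fun_le; rewrite ler_expR ltW.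
have hN := near (- Y) (lexx _) (lt_le_trans Fy FY).
have uY : expR (- (tau1 * - Y)) <= expR (- (tau1 * y)).
  by rewrite ler_expR lerN2 ler_pM2l// ltW.
have CuY : 2 <= C1 * expR (- (tau1 * - Y)) by rewrite mulrN opprK.
have Cuy : C1 * expR (- (tau1 * - Y)) <= C1 * expR (- (tau1 * y)) by rewrite ler_pM2l.
rewrite max_l in hN; last by lra.
rewrite max_l; last by lra.
move: hN; rewrite !subr0 !ger0_norm ?distr_fun_ge0// => hN.
apply: (le_trans FY); apply: (le_trans hN).
by rewrite ler_wpM2l// mulr_ge0.
Qed.

(** [tail_dist_second_order] with [k = 2 d A]. Left of [- Y] the second-order term is at least the
    main term, itself at least 1, and the band is trivial. Right of it, [F0] vanishing at [e^y']
    would force [F1 <= d A < k]. The summand [4 d A (C1 + C' + 1)] is the price of the cut below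
    [k]. *)
Lemma second_order_separation tau0 tau1 C0 C1 (C' b1 : R) b d Y A F0 F1 :
    0 < tau0 -> 0 < tau1 -> 0 < C0 -> 0 < C1 -> 0 < C' -> 0 < b1 -> 0 < b -> 0 < d ->
    second_order_pareto tau0 b%:E C0 C' F0 -> second_order_pareto tau1 b1%:E C1 C' F1 ->
    1 <= C1 * expR (tau1 * Y) -> C1 <= C' * expR (tau1 * b * Y) ->
    expR (tau1 * Y) <= A -> 2 * d * A <= 2^-1 ->
    (forall y, - Y <= y -> 0 < F1 (expR y) ->
      tails_compared b C' F0 F1 tau0 tau1 C0 C1 d y) ->
  (tail_dist_set tau1 F1 (second_order_pareto tau1 b%:E C1 C') <=
    (3 * d + 4 * d * A * (C1 + C' + 1))%:E)%E.
Proof.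
move=> tau00 tau10 C00 C10 C'0 b10 b0 d0 hF0 hF1 hY hYb YA dA comp.
have F0band := second_order_band hF0; have F1band := second_order_band hF1.
have A0 : 0 < A by apply: lt_le_trans YA; exact: expR_gt0.
have dA0 : 0 < d * A by exact: mulr_gt0.
have e0 : 0 < 4 * d * A * (C1 + C' + 1).
  by rewrite -!mulrA mulr_gt0// mulrA mulr_gt0// !addr_gt0.
apply: (@tail_dist_second_order _ _ _ _ _ _ (2 * d * A)) => //.
- lra.
- by rewrite -mulrA; lra.
- by case: hF1.
- move=> x x0 kx; have xE : expR (ln x) = x by rewrite lnK.
  rewrite !expR_powRN//; rewrite -{1}xE; rewrite -xE in kx; move: (ln x) kx => y ky.
  have Fy : 0 < F1 (expR y) by lra.
  rewrite [X in C' * expR X](_ : _ = - (tau1 * y) + - (tau1 * b * y)); last by ring.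
  rewrite expRD; set u := expR (- (tau1 * y)); set v := expR (- (tau1 * b * y)).
  have u0 : 0 < u by exact: expR_gt0.
  have v0 : 0 < v by exact: expR_gt0.
  have w0 : 0 <= C' * (u * v) by rewrite !mulr_ge0// ltW.
  have du : 0 <= d * u by rewrite mulr_ge0// ltW.
  have eu : 0 <= 4 * d * A * (C1 + C' + 1) * u by rewrite mulr_ge0// ltW.
  rewrite [X in _ <= _ + X]mulrDl.
  have [yY|yY] := leP (- Y) y; last first.
    have uY : expR (tau1 * Y) <= u.
      by rewrite ler_expR -mulrN ler_pM2l//; lra.
    have vY : expR (tau1 * b * Y) <= v.
      by rewrite ler_expR -mulrN ler_pM2l ?mulr_gt0//; lra.
    have : C1 * expR (tau1 * Y) <= C1 * u by rewrite ler_pM2l.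
    have : C1 * u <= C' * (u * v).
      rewrite mulrCA mulrC ler_pM2l//; apply: le_trans hYb _.
      by rewrite ler_pM2l.
    have := distr_fun_le1 F1 (expR y); rewrite ler_norml; lra.
  have [[h1 h2]|[y' [h1 h2 h3]]] := comp y yY Fy.
    by apply: le_trans h1 _; rewrite -/u; lra.
  rewrite -/u -/v in h1 h2 h3.
  have [F0y|F0y] := ltP 0 (F0 (expR y')).
    have := F0band y' F0y; move: h1 h2 h3; rewrite !ler_norml; lra.
  have F0E : F0 (expR y') = 0 by apply/eqP; rewrite eq_le F0y distr_fun_ge0.
  have uA : d * u <= d * A.
    rewrite ler_pM2l//; apply: le_trans YA; rewrite ler_expR -mulrN ler_pM2l//; lra.
  by move: h1; rewrite F0E subr0 ger0_norm ?distr_fun_ge0//; lra.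
- move=> x x0 /andP[Fx0 Fxk]; have xE : expR (ln x) = x by rewrite lnK.
  rewrite expR_powRN//; rewrite -xE in Fx0 Fxk *; move: (ln x) Fx0 Fxk => y Fy Fyk.
  rewrite expRK.
  set u := expR (- (tau1 * y)).
  have u0 : 0 < u by exact: expR_gt0.
  (* Where [F1] is below [2^-1], [x] cannot be large; thus [u] is bounded below and [k] is [O(d u)]
     with a factor [A]. *)
  have hu : 2^-1 <= (C1 + C' + 1) * u.
    have [y0|y0] := leP 0 y.
      have := tail_band_le (ltW C'0) (ltW tau10) (ltW b10) y0 F1band Fy.
      rewrite -/u; lra.
    have u1 : 1 <= u by rewrite -expR0 ler_expR oppr_ge0 mulr_ge0_le0 ?ltW.
    have : 0 <= (C1 + C') * u by rewrite mulr_ge0 ?addr_ge0 ?ltW.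
    rewrite mulrDl; lra.
  apply: le_trans (ltW Fyk) _.
  rewrite mulrDl.
  have : 4 * d * A * 2^-1 <= 4 * d * A * ((C1 + C' + 1) * u).
    by rewrite ler_wpM2l// -mulrA mulr_ge0// ltW.
  have : 0 <= 3 * d * u by rewrite !mulr_ge0// ltW.
  rewrite mulrA; lra.
Qed.

End separation.

(** * Rates *)

Section asymptotics.
Context {R : realType}.
Implicit Types (F : distr_fun R) (a b c tau C x y Y M : R).

Lemma near_ln_ge c : \forall n \near \oo, c <= ln (n%:R : R).
Proof.
near=> n; have h : expR c <= n%:R by near: n; exact: nbhs_infty_ger.
by rewrite -ler_expR lnK// posrE; apply: lt_le_trans h; exact: expR_gt0.
Unshelve. all: end_near. Qed.

(** From [expR t >= 1 + t^3 / 6]. The exponential smallness conditions on [n] are all brought to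
    this form with [x = ln n]; the square leaves room for logarithmic factors. *)
Lemma sqr_expRN_small a c x : 0 < a -> 0 <= c -> 0 < x -> 6 * c / a ^+ 3 <= x ->
  c * (x ^+ 2 * expR (- (a * x))) <= 1.
Proof.
move=> a0 c0 x0; rewrite ler_pdivrMr ?exprn_gt0// => cx.
rewrite expRN mulrA ler_pdivrMr ?expR_gt0// mul1r.
have := expR_ge1Dxn 2 (ltW (mulr_gt0 a0 x0)).
rewrite (_ : 3`!%:R = 6 :> R)// => h.
have : c * x ^+ 2 <= (a * x) ^+ 3 / 6%:R.
  rewrite ler_pdivlMr//.
  have : x ^+ 2 * (6 * c) <= x ^+ 2 * (x * a ^+ 3) by rewrite ler_wpM2l// sqr_ge0.
  rewrite exprMn !exprS expr0; lra.
lra.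
Qed.

Lemma near_sqr_expRN_small a c : 0 < a -> 0 <= c ->
  \forall n \near \oo, c * (ln (n%:R : R) ^+ 2 * expR (- (a * ln n%:R))) <= 1.
Proof.
move=> a0 c0; near=> n; apply: sqr_expRN_small => //.
  apply: (@lt_le_trans _ _ 1) => //; near: n; exact: near_ln_ge.
by near: n; exact: near_ln_ge.
Unshelve. all: end_near. Qed.

Definition rate (b1 : R) (n : nat) : R :=
  expR (- (b1 / (2 * b1 + 1) * ln n%:R)) * ln n%:R.

Lemma tails_compared_le b (C' : R) F0 F1 tau0 tau1 C0 C1 d d' y : d <= d' ->
  tails_compared b C' F0 F1 tau0 tau1 C0 C1 d y ->
  tails_compared b C' F0 F1 tau0 tau1 C0 C1 d' y.
Proof.
move=> dd'; have h : d * expR (- (tau1 * y)) <= d' * expR (- (tau1 * y)).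
  by rewrite ler_wpM2r// expR_ge0.
case=> [[h1 h2]|[y' [h1 h2 h3]]]; [left|right].
  by split=> //; exact: le_trans h1 h.
by exists y'; split; [exact: le_trans h1 h|exact: le_trans h2 h|exact: le_trans h3 h].
Qed.

(** [D] adds up the summands of [tail_err], each bounded by a multiple of the rate. Uniformity over
    the classes is obtained by replacing parameters with the ends of their intervals. *)
Lemma eventually_compared (tl th cl ch C' b1 : R) b M Y :
    0 < tl -> tl <= th -> 0 < cl -> cl <= ch -> 0 < C' -> 0 < b1 -> b1 <= b ->
    0 < M -> 0 <= Y ->
  exists2 D : R, 0 < D & \forall n \near \oo, forall F0 F1 tau0 tau1 C0 C1,
    tl <= tau0 <= th -> tl <= tau1 <= th -> cl <= C0 <= ch -> cl <= C1 <= ch ->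
    tail_band tau0 b C0 C' F0 -> tail_band tau1 b1 C1 C' F1 ->
    coupled n (2 * ln n%:R) M (ln n%:R / (2 * b1 + 1)) F0 F1 tau0 tau1 ->
    forall y, - Y <= y -> 0 < F1 (expR y) ->
    tails_compared b C' F0 F1 tau0 tau1 C0 C1 (D * rate b1 n) y.
Proof.
move=> tl0 tlh cl0 clh C'0 b10 b1b M0 Y0.
have th0 : 0 < th by exact: lt_le_trans tlh.
have ch0 : 0 < ch by exact: lt_le_trans clh.
have b0 : 0 < b by exact: lt_le_trans b1b.
pose m := 2 * b1 + 1; have m0 : 0 < m by rewrite /m; lra.
pose be := b1 / m; have be0 : 0 < be by exact: divr_gt0.
pose P := param_cst cl ch C' b1 / cl.
have P0 : 0 <= P by rewrite divr_ge0 ?(ltW cl0)// param_cst_ge0.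
pose E := expR (2 * b1 * th); have E0 : 0 < E by exact: expR_gt0.
pose c7 := P * (M + 1 + E).
have c70 : 0 <= c7 by rewrite mulr_ge0// !addr_ge0// ltW.
pose G := 2 * c7 + 4 * c7 / tl + 4 * c7 * (Y + tl^-1) + th.
have tlV : 0 < tl^-1 by rewrite invr_gt0.
have G0 : 0 < G.
  have h4 : 0 <= 4 * c7 by exact: mulr_ge0.
  have : 0 <= 4 * c7 / tl by rewrite mulr_ge0// ltW.
  have : 0 <= 4 * c7 * (Y + tl^-1) by apply: mulr_ge0 => //; lra.
  by rewrite /G; lra.
pose A1 := 161%:R * (ch + C' * expR (th * b1 * Y) + 2).
have A10 : 0 < A1.
  have : 0 < C' * expR (th * b1 * Y) by rewrite mulr_gt0 ?expR_gt0.
  by rewrite /A1; lra.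
pose A2 := 2 * ch + C' * (2 * (b + 1)) * expR (th * b * Y).
have A20 : 0 < A2.
  have : 0 < C' * (2 * (b + 1)) * expR (th * b * Y).
    by rewrite mulr_gt0 ?expR_gt0// mulr_gt0//; lra.
  by rewrite /A2; lra.
exists (C' * E + 2 * A1 + A2 * G).
  by apply: addr_gt0; [apply: addr_gt0|]; apply: mulr_gt0.
have P2E : 0 <= P * (2 + E) by rewrite mulr_ge0//; lra.
have q4 : 0 <= 4 * (P * (2 + E)) / tl ^+ 2.
  by rewrite divr_ge0 ?sqr_ge0// mulr_ge0.
have q5 : 0 <= 2 * ((b + 1) * G) by rewrite mulr_ge0// mulr_ge0 ?(ltW G0)//; lra.
have cmp0 := cmp_const_ge0 (ltW ch0) (ltW C'0).
have q6 : 0 <= 2 * ((ch + C' + cmp_const ch C') * expR (2 * th)).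
  by rewrite mulr_ge0// mulr_ge0 ?expR_ge0//; lra.
have q7 : 0 <= ch * expR (2 * th) by rewrite mulr_ge0 ?expR_ge0// ltW.
have q8 : 0 <= 2 * (C' * expR (2 * (tl * b))) / cl.
  by rewrite divr_ge0 ?(ltW cl0)// mulr_ge0// mulr_ge0 ?expR_ge0// ltW.
have q9 : 0 <= 2 / tl by rewrite divr_ge0// ltW.
pose a8 := tl * b / (m * th).
have a80 : 0 < a8 by rewrite divr_gt0// mulr_gt0.
have mV : 0 < m^-1 by rewrite invr_gt0.
near=> n => F0 F1 tau0 tau1 C0 C1 t0 t1 c0 c1 F0b F1b cpl y yY Fy.
have n0 : 0 < n%:R :> R by near: n; exact: nbhs_infty_gtr.
have Yn : Y <= n%:R by near: n; exact: nbhs_infty_ger.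
have x1 : 1 <= ln (n%:R : R) by near: n; exact: near_ln_ge.
have xth : 2 * th * m <= ln (n%:R : R) by near: n; exact: near_ln_ge.
have S1 : 2 * (ln (n%:R : R) ^+ 2 * expR (- (be * ln n%:R))) <= 1.
  by near: n; exact: near_sqr_expRN_small.
have S2 : (M + 1) * (ln (n%:R : R) ^+ 2 * expR (- (be * ln n%:R))) <= 1.
  by near: n; apply: near_sqr_expRN_small => //; lra.
have S3 : 2 * (P * (2 + E)) * (ln (n%:R : R) ^+ 2 * expR (- (be * ln n%:R))) <= 1.
  by near: n; apply: near_sqr_expRN_small => //; exact: mulr_ge0.
have S4 : 2 * c7 * (ln (n%:R : R) ^+ 2 * expR (- (be * ln n%:R))) <= 1.
  by near: n; apply: near_sqr_expRN_small => //; exact: mulr_ge0.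
have S5 : 4 * (P * (2 + E)) / tl ^+ 2 *
    (ln (n%:R : R) ^+ 2 * expR (- (be * ln n%:R))) <= 1.
  by near: n; exact: near_sqr_expRN_small.
have S6 : 2 * ((b + 1) * G) * (ln (n%:R : R) ^+ 2 * expR (- (be * ln n%:R))) <= 1.
  by near: n; exact: near_sqr_expRN_small.
have T1 : 2 * ((ch + C' + cmp_const ch C') * expR (2 * th)) *
    (ln (n%:R : R) ^+ 2 * expR (- (m^-1 * ln n%:R))) <= 1.
  by near: n; exact: near_sqr_expRN_small.
have T2 : ch * expR (2 * th) * (ln (n%:R : R) ^+ 2 * expR (- (m^-1 * ln n%:R))) <= 1.
  by near: n; exact: near_sqr_expRN_small.
have T3 : 2 * (C' * expR (2 * (tl * b))) / cl *
    (ln (n%:R : R) ^+ 2 * expR (- (a8 * ln n%:R))) <= 1.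
  by near: n; exact: near_sqr_expRN_small.
have T4 : 2 / tl * (ln (n%:R : R) ^+ 2 * expR (- (1 * ln n%:R))) <= 1.
  by near: n; exact: near_sqr_expRN_small.
have nx : n%:R = expR (ln (n%:R : R)) by rewrite lnK.
rewrite /rate -/m -/be; rewrite -/m in cpl.
move: (ln n%:R) => x in x1 xth S1 S2 S3 S4 S5 S6 T1 T2 T3 T4 nx cpl *.
have {S1 S2 S3 S4 S5} S := And5 S1 S2 S3 S4 S5.
have {S6 T1 T2 T3 T4} T := And5 S6 T1 T2 T3 T4.
pose r := expR (- (be * x)); have r0 : 0 < r by exact: expR_gt0.
rewrite -/r in S T *.
have r_le : r <= r * x by rewrite ler_peMr// ltW.
pose K := x / m; rewrite -/K in cpl.
have K_le : K <= x by rewrite ler_pdivrMr// ler_peMr ?(le_trans _ x1)// /m; clear - b10; lra.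
have KE : x = m * K by rewrite mulrC divfK ?gt_eqF.
have K0 : 0 <= K by rewrite divr_ge0 ?(ltW m0)//; clear - x1; lra.
have rE : expR (- (b1 * K)) = r by congr expR; rewrite /be /K; ring.
(* The balance behind [K]: [n = e^((2 b1 + 1) K)] and [r = e^(- b1 K)]. *)
have nE : n%:R^-1 = r ^+ 2 * expR (- K).
  rewrite nx -expRN -rE -expRM_natl -expRD; congr expR.
  by rewrite KE /m; ring.
have K1 : expR (- K) <= 1 by rewrite -expR0 ler_expR oppr_le0.
have r1 : r <= 1.
  by rewrite -rE -expR0 ler_expR oppr_le0 mulr_ge0// ltW.
have n_le : n%:R^-1 <= r.
  rewrite nE; apply: (@le_trans _ _ (r ^+ 2 * 1)).
    by rewrite ler_wpM2l// sqr_ge0.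
  by rewrite mulr1 expr2 ler_piMr// ltW.
have small c : c * (x ^+ 2 * r) <= 1 -> 0 <= c -> c * (r * x) <= 1 /\ c * r <= 1.
  move=> h c_ge0.
  have h2 : c * (r * x) <= c * (x ^+ 2 * r).
    by rewrite ler_wpM2l// mulrC ler_wpM2r ?(ltW r0)// expr2 ler_peMr//; clear - x1; lra.
  have h3 : c * r <= c * (r * x) by rewrite ler_wpM2l.
  by clear - h h2 h3; split; lra.
have Kx c : c * (x ^+ 2 * expR (- (m^-1 * x))) <= 1 -> 0 <= c -> c * expR (- K) <= 1.
  move=> h c_ge0; move: h; rewrite (mulrC m^-1) -/K; apply: le_trans.
  by rewrite ler_wpM2l// ler_peMl ?expR_ge0// expr2; clear - x1; nra.
(* Relative errors at mass [e^-K]: level [2 ln n] loses at most a factor [2 ln n] over [r], level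
   [M] only a constant. Since [growth_err] multiplies [s2] by [K], both contributions end at
   [r ln n]. *)
pose s1 := 2 * (r * x); pose s2 := (M + 1) * r.
have s1_ge0 : 0 <= s1 by rewrite /s1 mulr_ge0// mulr_ge0 ?(ltW r0)//; clear - x1; lra.
have s2_ge0 : 0 <= s2 by rewrite /s2 mulr_ge0 ?(ltW r0)//; clear - M0; lra.
have err1E : param_err th cl ch C' b1 K s1 <= P * (2 + E) * (r * x).
  rewrite /param_err rE -/P -/E -mulrA ler_wpM2l// /s1.
  have h : E * r <= E * (r * x) by rewrite ler_pM2l.
  by clear - h; lra.
have err2E : param_err th cl ch C' b1 K s2 = c7 * r.
  by rewrite /param_err rE -/P -/E /s2 /c7; ring.
have gE : growth_err tl th cl ch C' b1 n K s2 Y <= G * (r * x).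
  rewrite /growth_err err2E /G.
  have rK : r * K <= r * x by rewrite ler_pM2l.
  have e1 : c7 * r <= c7 * (r * x) by rewrite ler_wpM2l.
  have e2 : c7 * tl^-1 * (r * K) <= c7 * tl^-1 * (r * x).
    by rewrite ler_wpM2l// mulr_ge0// ltW.
  have e3 : c7 * Y * r <= c7 * Y * (r * x) by rewrite ler_wpM2l// mulr_ge0.
  have e4 : th * n%:R^-1 <= th * (r * x) by rewrite ler_pM2l//; apply: le_trans r_le.
  by clear - rK e1 e2 e3 e4; lra.
have A2gE : 2 * ch * growth_err tl th cl ch C' b1 n K s2 Y +
  C' * (2 * ((b + 1) * growth_err tl th cl ch C' b1 n K s2 Y)) * expR (th * b * Y) =
  A2 * growth_err tl th cl ch C' b1 n K s2 Y by rewrite /A2; ring.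
apply: (@tails_compared_le _ _ _ _ _ _ _ _ (tail_err tl th cl ch C' b1 b n K s1 s2 Y)).
  rewrite /tail_err -/E -/A1 rE -addrA A2gE.
  have h1 : A2 * growth_err tl th cl ch C' b1 n K s2 Y <= A2 * (G * (r * x)).
    by rewrite ler_pM2l.
  have h2 : C' * (E * r) <= C' * (E * (r * x)) by rewrite !ler_pM2l.
  by rewrite /s1; clear - h1 h2; lra.
have Ls : 0 <= 2 * x / n%:R <= s1 ^+ 2 * expR (- K).
  rewrite nE mulrA; apply/andP; split.
    by rewrite !mulr_ge0 ?expR_ge0 ?sqr_ge0//; clear - x1; lra.
  rewrite ler_wpM2r ?expR_ge0// /s1.
  have -> : (2 * (r * x)) ^+ 2 = (4 * x * x) * r ^+ 2 by ring.
  by rewrite ler_wpM2r ?sqr_ge0//; clear - x1; nra.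
have Ms : 0 <= M / n%:R <= s2 ^+ 2 * expR (- K).
  rewrite nE mulrA; apply/andP; split.
    by rewrite !mulr_ge0 ?expR_ge0 ?sqr_ge0// ltW.
  rewrite ler_wpM2r ?expR_ge0// /s2 exprMn ler_wpM2r ?sqr_ge0//.
  by clear - M0; nra.
have s1I : 0 <= s1 <= 1.
  by case: S => [/small S1 _ _ _ _]; rewrite s1_ge0; have [] := S1 ltac:(by []).
have s2I : 0 <= s2 <= 1.
  case: S => [_ /small S2 _ _ _]; rewrite s2_ge0.
  by have [] := S2 ltac:(clear - M0; lra).
have Kth : 2 <= K / th by rewrite ler_pdivlMr// ler_pdivlMr.
have Kn : K / tl < n%:R.
  rewrite nx; case: T => _ _ _ _; rewrite mul1r expRN mulrA ler_pdivrMr ?expR_gt0// mul1r.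
  have ex := expR_gt0 x; have h : K / tl <= x ^+ 2 / tl.
    by rewrite ler_pM2r//; apply: le_trans K_le _; rewrite expr2 ler_peMr//; clear - x1; lra.
  by move: h ex; clear; move=> h ex; rewrite mulrAC -mulrA; lra.
have smallK : (ch + C' + cmp_const ch C') * (expR (2 * th) * expR (- K)) <= 2^-1.
  case: T => [_ /Kx h _ _ _]; have {}h := h q6.
  by move: h; clear; lra.
have chK : ch * (expR (2 * th) * expR (- K)) <= 1.
  by case: T => [_ _ /Kx h _ _]; rewrite mulrA; exact: h.
have bandK : C' * expR (- (tl * b * (K / th - 2))) <= cl / 2.
  case: T => [_ _ _ h _].
  have -> : - (tl * b * (K / th - 2)) = 2 * (tl * b) + - (a8 * x).
    by rewrite /a8 /K; field; rewrite !gt_eqF.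
  have h1 : expR (- (a8 * x)) <= x ^+ 2 * expR (- (a8 * x)).
    by rewrite ler_peMl ?expR_ge0// expr2; clear - x1; nra.
  have h2 := le_trans (ler_wpM2l q8 h1) h.
  rewrite expRD ler_pdivlMr//; move: h2.
  rewrite mulrAC ler_pdivrMr// mul1r; clear; lra.
have err1 : param_err th cl ch C' b1 K s1 <= 2^-1.
  apply: le_trans err1E _; case: S => [_ _ /small h _ _].
  by have [] := h (mulr_ge0 (ler0n _ 2) P2E); clear; lra.
have err2 : param_err th cl ch C' b1 K s2 <= 2^-1.
  rewrite err2E; case: S => [_ _ _ /small h _].
  by have [] := h (mulr_ge0 (ler0n _ 2) c70); clear; lra.
have err1K : K * (4 * param_err th cl ch C' b1 K s1) <= tl ^+ 2.
  case: S => [_ _ _ _ h].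
  move: h; rewrite mulrAC ler_pdivrMr ?exprn_gt0// mul1r; apply: le_trans.
  apply: (@le_trans _ _ (K * (4 * (P * (2 + E) * (r * x))))).
    by rewrite ler_wpM2l// ler_pM2l.
  have -> : 4 * (P * (2 + E)) * (x ^+ 2 * r) = x * (4 * (P * (2 + E) * (r * x))) by ring.
  rewrite ler_wpM2r// mulr_ge0// mulr_ge0// mulr_ge0 ?(ltW r0)//.
  by clear - x1; lra.
have g2 : (b + 1) * growth_err tl th cl ch C' b1 n K s2 Y <= 2^-1.
  apply: (@le_trans _ _ ((b + 1) * (G * (r * x)))).
    by rewrite ler_wpM2l//; clear - b0; lra.
  case: T => [/small h _ _ _ _]; have [] := h q5; clear; lra.
have YI : 0 <= Y <= n%:R by rewrite Y0.
exact: (tail_comparison tl0 cl0 C'0 b10 b1b cpl F0b F1b t0 t1 c0 c1 Ls Ms s1I s2I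
  Kth Kn smallK bandK err1 err2 err1K chK YI g2 yY Fy).
Unshelve. all: end_near. Qed.

End asymptotics.

(** * Uniform separation, error probabilities and the choice of constants *)

Section consistency.
Context {R : realType}.
Implicit Types (F : distr_fun R) (tau C : R).

Lemma le_expR_norm_ln (c t Y : R) : 0 < c -> 0 < t -> `|ln c| / t <= Y ->
  c <= expR (t * Y).
Proof.
move=> c0 t0; rewrite ler_pdivrMr// mulrC => h.
by rewrite -[leLHS]lnK ?posrE// ler_expR; apply: le_trans h; exact: ler_norm.
Qed.

Lemma tail_scale_ge (cl tl C tau Y : R) : 0 < cl -> 0 < tl -> cl <= C -> tl <= tau ->
  `|ln (2 / cl)| / tl <= Y -> 2 <= C * expR (tau * Y).
Proof.
move=> cl0 tl0 clC tltau hY.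
have Y0 : 0 <= Y by apply: le_trans hY; rewrite divr_ge0// ltW.
have : 2 / cl <= expR (tl * Y) by apply: le_expR_norm_ln => //; exact: divr_gt0.
rewrite ler_pdivrMr// mulrC => /le_trans; apply.
by rewrite ler_pM ?expR_ge0 ?(ltW cl0)// ler_expR ler_wpM2r.
Qed.

Lemma rate_gt0 (b1 : R) n : 1 <= ln (n%:R : R) -> 0 < rate b1 n.
Proof. by move=> x1; rewrite mulr_gt0 ?expR_gt0//; lra. Qed.

Section eventually_separated.
Variables (tl th cl ch C' b1 M : R).
Hypotheses (tl0 : 0 < tl) (tlh : tl <= th) (cl0 : 0 < cl) (clh : cl <= ch).
Hypotheses (C'0 : 0 < C') (b10 : 0 < b1) (M0 : 0 < M).

(** Used by contraposition: an alternative farther than this from its null class is coupled with no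
    null distribution. *)
Definition separated_at (beta0 : \bar R) (D : R) (n : nat) : Prop :=
  forall F0 F1 tau0 tau1 C0 C1,
    tl <= tau0 <= th -> tl <= tau1 <= th -> cl <= C0 <= ch -> cl <= C1 <= ch ->
    second_order_pareto tau0 beta0 C0 C' F0 ->
    second_order_pareto tau1 b1%:E C1 C' F1 ->
    coupled n (2 * ln n%:R) M (ln n%:R / (2 * b1 + 1)) F0 F1 tau0 tau1 ->
  (tail_dist_set tau1 F1 (second_order_pareto tau1 beta0 C1 C') <=
    (D * rate b1 n)%:E)%E.

Lemma eventually_separated_pareto :
  exists2 D : R, 0 < D & \forall n \near \oo, separated_at +oo D n.
Proof.
pose Y := `|ln (2 / cl)| / tl.
have Y0 : 0 <= Y by rewrite divr_ge0// ltW.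
(* Any exponent at least [b1] serves, as Pareto laws satisfy every band. *)
have b1b : b1 <= b1 + 1 by rewrite lerDl.
have [D D0 hD] := eventually_compared tl0 tlh cl0 clh C'0 b10 b1b M0 Y0.
exists (2 * D); first exact: mulr_gt0.
have h1 := @near_ln_ge R 1; move: hD h1; apply: filterS2 => n hDn x1.
move=> F0 F1 tau0 tau1 C0 C1 t0 t1 c0 c1 hF0 hF1 cpl.
have cmpD := hDn F0 F1 tau0 tau1 C0 C1 t0 t1 c0 c1.
have /andP[tl0' _] := t0; have /andP[tl1 _] := t1.
have /andP[cl0' _] := c0; have /andP[cl1 _] := c1.
have t00 : 0 < tau0 by exact: lt_le_trans tl0'.
have t10 : 0 < tau1 by exact: lt_le_trans tl1.
have c00 : 0 < C0 by exact: lt_le_trans cl0'.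
have c10 : 0 < C1 by exact: lt_le_trans cl1.
have hcmp := cmpD (pareto_band _ t00 c00 (ltW C'0) hF0) (second_order_band hF1) cpl.
have Dr0 : 0 <= D * rate b1 n by rewrite mulr_ge0// ltW// rate_gt0.
have uY := tail_scale_ge cl0 tl0 cl1 tl1 (lexx _).
by rewrite -mulrA; exact: (pareto_separation t00 t10 c00 c10 Dr0 hF0 (proj1 hF1) uY hcmp).
Qed.

Lemma eventually_separated_second_order b : b1 <= b ->
  exists2 D : R, 0 < D & \forall n \near \oo, separated_at b%:E D n.
Proof.
move=> b1b; have C'p := C'0; have b1p := b10.
have th0 : 0 < th by exact: lt_le_trans tlh.
have ch0 : 0 < ch by exact: lt_le_trans clh.
have b0 : 0 < b by exact: lt_le_trans b1b.
(* The first summand makes the main term at least 2 at [- Y], the second makes the second-order term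
   at least as large as the main one. *)
pose Y := `|ln (2 / cl)| / tl + `|ln (ch / C')| / (tl * b).
have Y1 : 0 <= `|ln (2 / cl)| / tl by rewrite divr_ge0// ltW.
have Y2 : 0 <= `|ln (ch / C')| / (tl * b) by rewrite divr_ge0// mulr_ge0// ltW.
have Y0 : 0 <= Y by exact: addr_ge0.
have [D D0 hD] := eventually_compared tl0 tlh cl0 clh C'0 b10 b1b M0 Y0.
pose A := expR (th * Y); have A0 : 0 < A by exact: expR_gt0.
have be0 : 0 < b1 / (2 * b1 + 1) by rewrite divr_gt0//; lra.
have DA0 : 0 < 4 * D * A by rewrite mulr_gt0// mulr_gt0.
exists (3 * D + 4 * D * A * (ch + C' + 1)).
  have : 0 < 4 * D * A * (ch + C' + 1) by rewrite mulr_gt0//; lra.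
  lra.
have h1 := @near_ln_ge R 1; have h2 := near_sqr_expRN_small be0 (ltW DA0).
move: hD h1 h2.
apply: filterS3 => n hDn x1 small.
move=> F0 F1 tau0 tau1 C0 C1 t0 t1 c0 c1 hF0 hF1 cpl.
have cmpD := hDn F0 F1 tau0 tau1 C0 C1 t0 t1 c0 c1.
have /andP[tl0' _] := t0; have /andP[tl1 tl1'] := t1.
have /andP[cl0' _] := c0; have /andP[cl1 cl1'] := c1.
have t00 : 0 < tau0 by exact: lt_le_trans tl0'.
have t10 : 0 < tau1 by exact: lt_le_trans tl1.
have c00 : 0 < C0 by exact: lt_le_trans cl0'.
have c10 : 0 < C1 by exact: lt_le_trans cl1.
have hcmp := cmpD (second_order_band hF0) (second_order_band hF1) cpl.
have r0 := rate_gt0 b1 x1.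
have dA : 2 * (D * rate b1 n) * A <= 2^-1.
  have rx : rate b1 n <=
      ln (n%:R : R) ^+ 2 * expR (- (b1 / (2 * b1 + 1) * ln n%:R)).
    by rewrite /rate mulrC ler_wpM2r ?expR_ge0// expr2 ler_peMl//; lra.
  have := le_trans (ler_wpM2l (ltW DA0) rx) small; lra.
have uY : 1 <= C1 * expR (tau1 * Y).
  have : 2 <= C1 * expR (tau1 * Y) by apply: (tail_scale_ge cl0 tl0) => //; rewrite lerDl.
  lra.
have vY : C1 <= C' * expR (tau1 * b * Y).
  have : ch / C' <= expR (tl * b * Y).
    by apply: le_expR_norm_ln; rewrite ?divr_gt0 ?mulr_gt0// lerDr.
  rewrite ler_pdivrMr// mulrC => h; apply: (le_trans cl1'); apply: (le_trans h).
  by rewrite ler_pM2l// ler_expR ler_wpM2r// ler_wpM2r// ltW.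
have AY : expR (tau1 * Y) <= A by rewrite ler_expR ler_wpM2r.
have d0 : 0 < D * rate b1 n by exact: mulr_gt0.
apply: le_trans (second_order_separation t00 t10 c00 c10 C'0 b10 b0 d0 hF0 hF1
  uY vY AY dA hcmp) _.
have : 4 * D * A * rate b1 n * (C1 + C' + 1) <= 4 * D * A * rate b1 n * (ch + C' + 1).
  by rewrite ler_pM2l ?(mulr_gt0 DA0 r0)// !lerD2r.
rewrite lee_fin; lra.
Qed.

Lemma eventually_separated (beta0 : \bar R) : (b1%:E < beta0)%E ->
  exists2 D : R, 0 < D & \forall n \near \oo, separated_at beta0 D n.
Proof.
case: beta0 => [b||]//; last by move=> _; exact: eventually_separated_pareto.
by rewrite lte_fin => /ltW; exact: eventually_separated_second_order.
Qed.

End eventually_separated.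

Lemma limn_esup_le_cst (u : (\bar R)^nat) (l : \bar R) :
  (forall n, u n <= l)%E -> (limn_esup u <= l)%E.
Proof.
move=> ul; apply: ge_ereal_inf; exists (ereal_sup (range u)).
  by exists setT => //; exact: filterT.
by apply: ge_ereal_sup => _ [n _ <-].
Qed.

(** With [L = 2 ln n] the uniform part is [4 n / n^2 = 4 / n]. By [1 + z <= e^z] the other is at
    most [14 alpha / 56 = alpha / 4], whence the level [M = 56 / alpha], free of [n]. *)
Lemma error_bound (alpha : R) n : 0 < alpha -> 0 < n%:R :> R -> 16%:R / alpha <= n%:R ->
  (4 * n)%:R * expR (- (2 * ln n%:R)) + 14%:R * expR (- (56%:R / alpha)) <= alpha / 2.
Proof.
move=> a0 n0; rewrite ler_pdivrMr// => an.
have -> : (4 * n)%:R * expR (- (2 * ln n%:R)) = 4 / n%:R :> R.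
  rewrite natrM expRN expRM_natl lnK ?posrE//; field.
  by rewrite gt_eqF.
have M0 : 0 < 56%:R / alpha by rewrite divr_gt0.
have h1 : 14%:R * expR (- (56%:R / alpha)) <= alpha / 4.
  have := expR_ge1Dx (56%:R / alpha); rewrite expRN ler_pdivrMr ?expR_gt0// => h.
  have : alpha / 4 * (56%:R / alpha) = 14%:R by field; rewrite gt_eqF.
  move=> <-; rewrite ler_pM2l ?divr_gt0//; lra.
have h2 : 4 / n%:R <= alpha / 4 by rewrite ler_pdivrMr//; lra.
lra.
Qed.

Lemma sup_expect_le n (H : set (distr_fun R)) f (e : R) : 0 <= e ->
  (forall F, H F -> expect (n := n) F f <= e%:E)%E -> (sup_expect H f <= e%:E)%E.
Proof.
move=> e0 He; apply: ge_ereal_sup => _ [->|[F HF <-]]; first by rewrite lee_fin.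
exact: He.
Qed.

Lemma rate_ge0 (b1 : R) n : 0 <= rate b1 n.
Proof.
rewrite mulr_ge0 ?expR_ge0//; case: n => [|n]; first by rewrite ln0.
by rewrite ln_ge0// ler1n.
Qed.

Lemma rate_normalized (D b1 : R) n : 0 <= D ->
  D * rate b1 n * (n%:R `^ (b1 / (2 * b1 + 1)) / ln n%:R) <= D.
Proof.
(* At [n = 0] and [n = 1] the logarithm is 0 and so is the product. *)
move=> D0; case: n => [|n]; first by rewrite /rate ln0// !(mulr0, mul0r).
have n0 : 0 < n.+1%:R :> R by rewrite ltr0n.
rewrite /rate /powR gt_eqF// expRN.
have [->|l0] := eqVneq (ln n.+1%:R : R) 0; first by rewrite !(mulr0, mul0r).
set E := expR _; have E0 : E != 0 by rewrite gt_eqF// expR_gt0.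
by rewrite le_eqVlt; apply/orP; left; apply/eqP; field; rewrite E0 l0.
Qed.

End consistency.

Theorem theorem3p2 (R : realType) (alpha : R) (beta0 : \bar R) (beta1 C' : R)
    (tau_lo tau_hi C_lo C_hi : R)
    (halpha : 0 < alpha) (hbeta1 : 0 < beta1) (hbeta : (beta1%:E < beta0)%E)
    (hC' : 0 < C')
    (htau_lo : 0 < tau_lo) (htau : tau_lo <= tau_hi)
    (hC_lo : 0 < C_lo) (hC : C_lo <= C_hi) :
  exists rho : nat -> R,
    [/\ forall n, 0 <= rho n,
        (limn_esup (fun n => (rho n * (n%:R `^ (beta1 / (2 * beta1 + 1)) /
                                       ln n%:R))%:E) < +oo)%E
      & exists Psi : forall n, test R n,
          uniformly_consistent alpha Psi
            (\bigcup_(tau in `[tau_lo, tau_hi]) \bigcup_(C in `[C_lo, C_hi])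
               second_order_pareto tau beta0 C C')
            (fun n =>
             \bigcup_(tau in `[tau_lo, tau_hi]) \bigcup_(C in `[C_lo, C_hi])
               separated_pareto tau beta1%:E beta0 C C' (rho n))].
Proof.
pose M := 56%:R / alpha.
have M0 : 0 < M by rewrite divr_gt0.
have [D D0 hD] :=
  eventually_separated htau_lo htau hC_lo hC hC' hbeta1 M0 hbeta.
(* [D + 1] rather than [D], so that separation strictly exceeds the bound for coupled pairs. *)
pose rho n := (D + 1) * rate beta1 n.
have D1 : 0 <= D + 1 by lra.
exists rho; split.
- by move=> n; rewrite mulr_ge0// rate_ge0.
- apply: (@le_lt_trans _ _ (D + 1)%:E); last exact: ltry.
  by apply: limn_esup_le_cst => n; rewrite lee_fin rate_normalized.
pose S0 := [set s : distr_fun R * R | exists2 C, C_lo <= C <= C_hi &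
  tau_lo <= s.2 <= tau_hi /\ second_order_pareto s.2 beta0 C C' s.1].
pose S1 n := [set s : distr_fun R * R | exists2 C, C_lo <= C <= C_hi &
  tau_lo <= s.2 <= tau_hi /\ separated_pareto s.2 beta1%:E beta0 C C' (rho n) s.1].
pose e n : R := (4 * n)%:R * expR (- (2 * ln n%:R)) + 14%:R * expR (- M).
have test_n n : exists Psi : test R n,
    (0 < n)%N -> 1 <= ln (n%:R : R) ->
    separated_at tau_lo tau_hi C_lo C_hi C' beta1 M beta0 D n ->
    (forall s, S0 s -> (expect s.1 (fun t => (Psi t)%:R%R) <= (e n)%:E)%E) /\
    (forall s, S1 n s -> (expect s.1 (fun t => 1 - (Psi t)%:R)%R <= (e n)%:E)%E).
  have [[n0 [x1 sep]]|no] := pselect ((0 < n)%N /\ 1 <= ln (n%:R : R) /\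
    separated_at tau_lo tau_hi C_lo C_hi C' beta1 M beta0 D n); last first.
    (* Where the bound is not yet available any test will do, consistency being asymptotic. *)
    by exists (cst false : test R n) => n0 x1 sep; exfalso; exact: no.
  have L1 : 1 <= 2 * ln (n%:R : R) by lra.
  have K0 : 0 <= ln (n%:R : R) / (2 * beta1 + 1) by rewrite divr_ge0//; lra.
  have S_gt0 s : S0 s \/ S1 n s -> 0 < s.2.
    by case=> -[C _ [/andP[h _] _]]; exact: lt_le_trans h.
  have S01 s0 s1 : S0 s0 -> S1 n s1 ->
      ~ coupled n (2 * ln n%:R) M (ln n%:R / (2 * beta1 + 1)) s0.1 s1.1 s0.2 s1.2.
    move=> [C0 c0 [t0 h0]] [C1 c1 [t1 [h1 far]]] cpl.
    have := le_trans far (sep _ _ _ _ _ _ t0 t1 c0 c1 h0 h1 cpl).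
    by rewrite lee_fin /rho ler_pM2r ?rate_gt0// => h; lra.
  have [Psi hPsi] := test_of_uncoupled n0 L1 M0 K0 S_gt0 S01.
  by exists Psi.
exists (fun n => projT1 (cid (test_n n))).
have h1 := @near_ln_ge R 1.
have h2 : \forall n \near \oo, 0 < n%:R :> R /\ 16%:R / alpha <= n%:R.
  by near=> n; split; near: n; [exact: nbhs_infty_gtr|exact: nbhs_infty_ger].
move: hD h1 h2; apply: filterS3 => n sep x1 [n0 an].
have nn : (0 < n)%N by rewrite -(ltr_nat R).
have [hS0 hS1] := projT2 (cid (test_n n)) nn x1 sep.
have en : e n <= alpha / 2 by exact: error_bound.
have a2 : 0 <= alpha / 2 by lra.
have -> : alpha%:E = ((alpha / 2)%:E + (alpha / 2)%:E)%E.
  by rewrite -EFinD; congr EFin; lra.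
apply: leeD.
- apply: sup_expect_le => // F [tau taui [C Ci hF]].
  apply: (@le_trans _ _ (e n)%:E); last by rewrite lee_fin.
  apply: (hS0 (F, tau)); exists C; first by move: Ci; rewrite /= in_itv.
  by split=> //; move: taui; rewrite /= in_itv.
- apply: sup_expect_le => // F [tau taui [C Ci hF]].
  apply: (@le_trans _ _ (e n)%:E); last by rewrite lee_fin.
  apply: (hS1 (F, tau)); exists C; first by move: Ci; rewrite /= in_itv.
  by split=> //; move: taui; rewrite /= in_itv.
Unshelve. all: end_near. Qed.
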